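(* Suppose that $\phi$ satisfies Grey's condition. Then the transition semigroup $(Q_t)_{t\ge0}$ on $[0,\infty)$ defined by $$\int_{[0,\infty)}e^{-\lambda y}\,Q_t(x,dy)=\mathbf{E}\big[e^{-xv^\xi_{0,t}(\lambda)}\big],\qquad \lambda\ge0,\ x\ge 0,$$ has the strong Feller property.
   Context: ''Positive'' means nonnegative. $\mathbf{E}$ is expectation under $\mathbf{P}$. Strong Feller property: for every $t>0$ and every bounded Borel function $f$ on $[0,\infty)$, the function $x\mapsto Q_tf(x)=\int f(y)\,Q_t(x,dy)$ is continuous on $[0,\infty)$. Branching mechanism: $b\in\mathbb{R}$, $c\ge 0$, $m$ a measure on $(0,\infty)$ with $\int_0^\infty (z\wedge z^2)\,m(dz)<\infty$, and $\phi(z)=bz+cz^2+\int_0^\infty(e^{-uz}-1+uz)\,m(du)$, $z\ge0$. Grey's condition: there is $\theta>0$ with $\phi(z)>0$ for $z\ge\theta$ and $\int_\theta^\infty\phi(z)^{-1}\,dz<\infty$ (when $b\ge 0$ and $\phi\not\equiv0$ this is the same as $\int_1^\infty\phi(z)^{-1}\,dz<\infty$). Environment: $\xi$ is a real Lévy process with càdlàg paths and Lévy–Itô decomposition $$\xi(t)=\xi(0)+at+\sigma B(t)+\int_0^t\int_{[-1,1]}z\,\tilde N(ds,dz)+\int_0^t\int_{\mathbb{R}\setminus[-1,1]}z\,N(ds,dz),$$ where $a\in\mathbb{R}$, $\sigma\ge0$, $B$ is a Brownian motion, and $N$ is a Poisson random measure on $(0,\infty)\times\mathbb{R}$ with intensity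 $ds\,\nu(dz)$ and compensated measure $\tilde N$, $\nu$ being a measure on $\mathbb{R}\setminus\{0\}$ with $\int(1\wedge z^2)\,\nu(dz)<\infty$. For $t\ge0$, $\lambda\ge0$, $r\mapsto v^\xi_{r,t}(\lambda)$ is the unique positive solution of $v^\xi_{r,t}(\lambda)=e^{\xi(t)-\xi(r)}\lambda-\int_r^t e^{\xi(s)-\xi(r)}\phi(v^\xi_{s,t}(\lambda))\,ds$, $0\le r\le t$. $(Q_t)_{t\ge 0}$ is the transition semigroup of the CBRE-process, the unique nonnegative strong solution of $$X(t)=X(0)-b\int_0^t X(s)\,ds+\int_0^t\sqrt{2cX(s)}\,dW(s)+\int_0^t\int_0^\infty\int_0^{X(s-)}z\,\tilde M(ds,dz,du)+\int_0^t X(s-)\,dL(s),$$ where $W$ is a Brownian motion, $\tilde M$ is a compensated Poisson random measure on $(0,\infty)^3$ with intensity $ds\,m(dz)\,du$, and $L$ is the Lévy process $L(t)=L(0)+\beta t+\sigma B(t)+\int_0^t\int_{[-1,1]}(e^z-1)\,\tilde N(ds,dz)+\int_0^t\int_{\mathbb{R}\setminus[-1,1]}(e^z-1)\,N(ds,dz)$ with $L(0)=\xi(0)$, $\beta=a+\frac{\sigma^2}{2}+\int_{[-1,1]}(e^z-1-z)\,\nu(dz)$; $W$, $M$, $L$ are independent. *)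

(* Defs.v *)
From HB Require Import structures.
From mathcomp Require Import all_boot all_order all_algebra.
From mathcomp Require Import all_classical all_reals all_analysis.
From mathcomp Require Import measurable_realfun.

Set Implicit Arguments.
Unset Strict Implicit.
Unset Printing Implicit Defensive.

Import Order.TTheory GRing.Theory Num.Theory.
Import numFieldNormedType.Exports.

Local Open Scope classical_set_scope.
Local Open Scope ring_scope.

(* Time parameters and points of the state space [0, +oo[ range over R, with
   explicit nonnegativity conditions; values at negative arguments are
   irrelevant. *)

Section branching_mechanism.
Context (R : realType).

Definition branching_measure (m : {measure set (measurableTypeR R) -> \bar R})
  : Prop := (\int[m]_(z in `]0%R, +oo[) (Num.min z (z ^+ 2))%:E < +oo)%E.

Definition branching_mechanism (b c : R)
    (m : {measure set (measurableTypeR R) -> \bar R}) (z : R) : R :=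
  b * z + c * z ^+ 2
  + \int[m]_(u in `]0, +oo[) (expR (- (u * z)) - 1 + u * z).

Definition grey_condition (phi : R -> R) : Prop :=
  exists theta : R, [/\ 0 < theta,
    (forall z, theta <= z -> 0 < phi z) &
    (\int[lebesgue_measure]_(z in `[theta, +oo[) ((phi z)^-1)%:E < +oo)%E].

End branching_mechanism.

Section independence.
Context d (Om : measurableType d) (R : realType) (P : probability Om R).

(* Since some of the A i can be setT, this gives the product rule for every
   subfamily. *)
Definition mutually_independent d' (T : measurableType d') (n : nat)
    (X : 'I_n -> Om -> T) : Prop :=
  forall A : 'I_n -> set T, (forall i, measurable (A i)) ->
    P (\bigcap_(i in [set: 'I_n]) (X i @^-1` A i)) =
    (\prod_(i < n) P (X i @^-1` A i))%E.

Definition generated_sigma_algebra d' (T : measurableType d') (I : Type)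
    (D : set I) (X : I -> Om -> T) : set (set Om) :=
  <<s \bigcup_(i in D) [set X i @^-1` A | A in @measurable d' T] >>.

Definition independent_systems (G H : set (set Om)) : Prop :=
  forall E F, G E -> H F -> P (E `&` F) = (P E * P F)%E.

End independence.

Section processes.
Context (R : realType).

Definition cadlag (f : R -> R) : Prop :=
  (forall t : R, 0 <= t -> f s @[s --> t^'+] --> f t) /\
  (forall t : R, 0 < t -> cvg (f s @[s --> t^'-])).

Context d (Om : measurableType d) (P : probability Om R).

Definition independent_increments (X : R -> Om -> R) : Prop :=
  forall (n : nat) (t : nat -> R), 0 <= t 0%N ->
    {homo t : i j / (i <= j)%N >-> i <= j} ->
    mutually_independent P
      (fun (i : 'I_n) w => X (t i.+1) w - X (t i) w : measurableTypeR R).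

(* The starting point X 0 is an arbitrary random variable. *)
Definition cadlag_levy_process (X : R -> Om -> R) : Prop :=
  [/\ (forall t : R, 0 <= t -> measurable_fun setT (X t)),
      independent_increments X,
      (forall s t : R, 0 <= s -> 0 <= t -> forall A : set (measurableTypeR R),
        measurable A ->
        P [set w | A (X (s + t) w - X s w)] = P [set w | A (X t w - X 0 w)]) &
      (forall w, cadlag (X ^~ w))].

Definition brownian_motion (B : R -> Om -> R) : Prop :=
  [/\ (forall t : R, 0 <= t -> measurable_fun setT (B t)),
      (forall w, B 0 w = 0),
      (forall w, {within `[0, +oo[, continuous (B ^~ w)}),
      independent_increments B &
      (forall s t : R, 0 <= s -> s < t -> forall A : set (measurableTypeR R),
        measurable A ->
        P [set w | A (B t w - B s w)] = normal_prob 0 (Num.sqrt (t - s)) A)].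

(* The point 0 is excluded from the state space of jumps by nu [set 0] = 0. *)
Definition levy_measure (nu : {measure set (measurableTypeR R) -> \bar R})
  : Prop :=
  nu [set 0] = 0%E /\ (\int[nu]_z (Num.min 1 (z ^+ 2))%:E < +oo)%E.

(* ds nu(dz) on ]0, +oo[ x R, seen as a measure on R x R *)
Definition jump_intensity (nu : {measure set (measurableTypeR R) -> \bar R})
    (A : set (measurableTypeR R * measurableTypeR R)) : \bar R :=
  (lebesgue_measure \x nu)%E (A `&` (`]0, +oo[ `*` setT)).

(* The second argument of poisson_prob is a dummy. *)
Definition poisson_random_measure
    (mu : set (measurableTypeR R * measurableTypeR R) -> \bar R)
    (N : R.-ker Om ~> (measurableTypeR R * measurableTypeR R)%type) : Prop :=
  [/\ (forall A, measurable A -> (mu A < +oo)%E -> forall k : nat,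
        P [set w | N w A = k%:R%:E] =
        poisson_prob (fine (mu A)) 0 [set k]),
      (forall A, measurable A -> mu A = +oo%E ->
        {ae P, forall w, N w A = +oo%E}) &
      (forall (n : nat)
         (A : 'I_n -> set (measurableTypeR R * measurableTypeR R)),
        (forall i, measurable (A i)) -> trivIset setT A ->
        mutually_independent P (fun i w => N w (A i)))].

(* J t = int_0^t int_[-1,1] z Ntilde(ds, dz), as the limit in L^2(P), for
   eps -> 0+, of the compensated integrals over the jumps of size > eps *)
Definition compensated_small_jumps
    (nu : {measure set (measurableTypeR R) -> \bar R})
    (N : R.-ker Om ~> (measurableTypeR R * measurableTypeR R)%type)
    (J : R -> Om -> R) : Prop :=
  forall t : R, 0 <= t -> measurable_fun setT (J t) /\
    (fun eps : R => 'E_P[fun w => ((J t w -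
        (\int[N w]_(p in `]0, t] `*` [set z | eps < `|z| <= 1]) p.2
         - t * \int[nu]_(z in [set z | eps < `|z| <= 1]) z)) ^+ 2)%R]%E)
      @ 0^'+ --> 0%E.

Definition levy_ito_decomposition (a sigma : R)
    (nu : {measure set (measurableTypeR R) -> \bar R})
    (xi : R -> Om -> R) : Prop :=
  exists (B : R -> Om -> R)
    (N : R.-ker Om ~> (measurableTypeR R * measurableTypeR R)%type)
    (J : R -> Om -> R),
    [/\ brownian_motion B,
        poisson_random_measure (jump_intensity nu) N,
        independent_systems P
          (@generated_sigma_algebra _ Om _ (measurableTypeR R) _
            [set t : R | 0 <= t] B)
          (generated_sigma_algebra measurable (fun A w => N w A)),
        compensated_small_jumps nu N J &
        {ae P, forall w, forall t : R, 0 <= t ->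
          xi t w = xi 0 w + a * t + sigma * B t w + J t w
            + \int[N w]_(p in `]0, t] `*` [set z | 1 < `|z|]) p.2}].

End processes.

Section transition_semigroups.
Context (R : realType).

(* Nonnegative solution r |-> v_{r,t}(lam) of the backward equation driven by
   the path x; the integrability condition makes the right-hand side
   meaningful (the library's integral is total). *)
Definition cumulant_solution (phi x : R -> R) (t lam : R) (v : R -> R)
  : Prop :=
  [/\ (forall r : R, 0 <= r <= t -> 0 <= v r),
      lebesgue_measure.-integrable `[0, t]
        (fun s => (expR (x s) * phi (v s))%:E) &
      (forall r : R, 0 <= r <= t ->
        v r = expR (x t - x r) * lam
          - \int[lebesgue_measure]_(s in `[r, t])
              (expR (x s - x r) * phi (v s)))].

(* A kernel on [0, +oo[ is represented by a kernel on R that maps points of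
   [0, +oo[ to probability measures carried by [0, +oo[. *)
Definition transition_semigroup
    (Q : R -> R.-pker (measurableTypeR R) ~> (measurableTypeR R)) : Prop :=
  [/\ (forall t x : R, 0 <= t -> 0 <= x -> Q t x `[0, +oo[%classic = 1%E),
      (forall (x : R) (A : set (measurableTypeR R)),
        0 <= x -> measurable A -> Q 0 x A = \d_x A) &
      (forall (s t x : R) (A : set (measurableTypeR R)),
        0 <= s -> 0 <= t -> 0 <= x -> measurable A ->
        Q (s + t) x A = (\int[Q s x]_(y in `[0%R, +oo[) Q t y A)%E)].

Definition strong_feller
    (Q : R -> R.-pker (measurableTypeR R) ~> (measurableTypeR R)) : Prop :=
  forall (t : R) (f : R -> R), 0 < t ->
    measurable_fun (`[0, +oo[ : set (measurableTypeR R)) f ->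
    (exists M : R, forall y : R, 0 <= y -> `|f y| <= M) ->
    {within `[0, +oo[, continuous
      (fun x : R => \int[Q t x]_(y in `[0, +oo[) f y)}.

End transition_semigroups.

(* Main.v *)
Require Import Defs.
From HB Require Import structures.
From mathcomp Require Import all_boot all_order all_algebra.
From mathcomp Require Import all_classical all_reals all_analysis.
From mathcomp Require Import measurable_realfun ring lra.

Set Implicit Arguments.
Unset Strict Implicit.
Unset Printing Implicit Defensive.

Import Order.TTheory GRing.Theory Num.Theory.
Import numFieldNormedType.Exports.

Local Open Scope classical_set_scope.
Local Open Scope ring_scope.

(** Fix [t > 0] and write [v(lam)] for the cumulant at time [0] and [vbar] for
    its limit as [lam] tends to infinity; both depend on the environment.
    Conditionally on the environment, the law of the process at time [t]
    started from [x] has Laplace transform [exp (- x v)], so that starting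
    from [x + h] means adding an independent copy started from [h], and this
    copy is extinct at time [t] with conditional probability
    [exp (- h vbar)].  Hence the laws at time [t] from [x] and from [x + h]
    differ in total variation by at most a multiple of
    [E (1 - exp (- h vbar))].  Grey's condition makes [vbar] finite on every
    path, and this bound tends to [0] with [h] by dominated convergence.

    The quenched laws are not among the data, only the Laplace transforms of
    their averages are.  What they would provide is that [exp (- x v)] is, for
    each environment and each [x], the Laplace transform of a positive
    measure, and this can be expressed without measures: a linear functional
    on the sums [sum_i a_i exp (- l_i y)] is positive when it takes
    nonnegative values on the sums that are nonnegative for all [y >= 0].
    The functions [L] for which [exp (- l y) |-> L l] extends to a positive
    functional ([laplace_type]) are stable under sums, products, limits and
    substitution, which makes the class [bernstein] of the [g] such that all
    [exp (- x g)], [x >= 0], are of this type stable under sums, composition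
    and limits.

    That [v] is [bernstein] ([cumulant_bernstein]) follows by discretisation:
    in the variable [w = exp (xi) v] the equation reads
    [w' = exp (xi) phi (exp (- xi) w)]; when [phi] is replaced by a mechanism
    with finitely many jumps, one backward Euler step
    [w |-> w - h a psi (w / a)] is the sum of a linear map and of a constant
    minus a Laplace transform ([approx_mechanism_bernstein]), and the scheme
    converges ([euler_cvg]).  Its stability constant [(1 + h |b|) ^ n] only
    depends on the drift, because the rest of the mechanism is nondecreasing.
    The scheme also gives the measurability of [v] in the environment.

    The comparison of the two laws is first made on sums of exponentials
    ([bernstein_comb_diff]) and then on bounded Borel functions: on a finite
    measure space every measurable function with values in [[0, 1]] is a
    limit in mean of sums of exponentials with values in [[0, 1]]
    ([expsum_approx_measurable]). *)

(** * Positive functionals on sums of exponentials *)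

Section exponential_combinations.
Context {R : realType}.
Implicit Types (s : seq (R * R)) (L K g : R -> R) (l x y : R).

(** The list [s] encodes a sum of exponentials by its pairs (coefficient,
    exponent); [comb s L] is the value on it of the linear functional that
    sends the exponential of exponent [l] to [L l]. *)
Definition comb s L : R := \sum_(p <- s) p.1 * L p.2.

Definition expsum s y : R := comb s (fun l => expR (- (l * y))).

Definition nneg_exps s : Prop := forall p, p \in s -> 0 <= p.2.

(** The Laplace transforms of the finite measures on [[0, +oo]]: a mass at the
    point at infinity only contributes to the value at [l = 0]. *)
Definition laplace_type L : Prop := forall s, nneg_exps s ->
  (forall y, 0 <= y -> 0 <= expsum s y) -> 0 <= comb s L.

(** The Laplace exponents of the subordinators, possibly killed. *)
Definition bernstein g : Prop := (forall l, 0 <= l -> 0 <= g l) /\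
  forall x, 0 <= x -> laplace_type (fun l => expR (- (x * g l))).

Lemma eq_comb s L K : nneg_exps s -> (forall l, 0 <= l -> L l = K l) ->
  comb s L = comb s K.
Proof.
by move=> s0 LK; rewrite /comb; apply: eq_big_seq => p ps; rewrite LK// s0.
Qed.

Lemma comb_cons p s L : comb (p :: s) L = p.1 * L p.2 + comb s L.
Proof. by rewrite /comb big_cons. Qed.

Lemma combD s L K : comb s (fun l => L l + K l) = comb s L + comb s K.
Proof. by rewrite /comb -big_split; apply: eq_bigr => p _; rewrite mulrDr. Qed.

Lemma combZ s k L : comb s (fun l => k * L l) = k * comb s L.
Proof. by rewrite /comb mulr_sumr; apply: eq_bigr => p _; rewrite mulrCA. Qed.

Lemma comb_map s (h : R -> R) (q : R -> R) L :
  comb [seq (p.1 * h p.2, q p.2) | p <- s] L =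
  comb s (fun l => h l * L (q l)).
Proof. by rewrite /comb big_map; apply: eq_bigr => p _; rewrite mulrA. Qed.

Lemma comb_cvg s (Ln : nat -> R -> R) L : nneg_exps s ->
  (forall l, 0 <= l -> Ln n l @[n --> \oo] --> L l) ->
  comb s (Ln n) @[n --> \oo] --> comb s L.
Proof.
move=> s0 LnL; rewrite /comb.
elim: s s0 => [|p s IH] s0.
  by under eq_fun do rewrite big_nil; rewrite big_nil; exact: cvg_cst.
under eq_fun do rewrite big_cons; rewrite big_cons.
apply: cvgD; first by apply: cvgMl_tmp; apply: LnL; apply: s0; rewrite mem_head.
by apply: IH => q qs; apply: s0; rewrite in_cons qs orbT.
Qed.

Lemma eq_laplace_type L K : (forall l, 0 <= l -> L l = K l) ->
  laplace_type L -> laplace_type K.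
Proof. by move=> LK HL s s0 s1; rewrite -(eq_comb s0 LK); exact: HL. Qed.

Lemma laplace_type_exp y : 0 <= y -> laplace_type (fun l => expR (- (l * y))).
Proof. by move=> y0 s _; exact. Qed.

Lemma laplace_type_cvg (Ln : nat -> R -> R) L :
  (\forall n \near \oo, laplace_type (Ln n)) ->
  (forall l, 0 <= l -> Ln n l @[n --> \oo] --> L l) -> laplace_type L.
Proof.
move=> HLn LnL s s0 s1; have cv := comb_cvg s0 LnL.
apply: (cvgr_to_ge cv).
by near=> n; apply: (near HLn n) => //.
Unshelve. all: end_near. Qed.

Lemma laplace_typeD L K : laplace_type L -> laplace_type K ->
  laplace_type (fun l => L l + K l).
Proof.
by move=> HL HK s s0 s1; rewrite combD addr_ge0//; [exact: HL|exact: HK].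
Qed.

Lemma laplace_typeZ k L : 0 <= k -> laplace_type L ->
  laplace_type (fun l => k * L l).
Proof. by move=> k0 HL s s0 s1; rewrite combZ mulr_ge0//; exact: HL. Qed.

(** When every [exp (- y g)] is of Laplace type, replacing each exponent [l] of
    a nonnegative sum by [g l] leaves it nonnegative, hence admissible for
    [L]. *)
Lemma laplace_type_subst L g : (forall l, 0 <= l -> 0 <= g l) ->
  (forall y, 0 <= y -> laplace_type (fun l => expR (- (g l * y)))) ->
  laplace_type L -> laplace_type (fun l => L (g l)).
Proof.
move=> g0 gL HL s s0 s1.
pose s' := [seq (p.1 * 1, g p.2) | p <- s].
have sE K : comb s' K = comb s (fun l => K (g l)).
  rewrite /s' (comb_map s (fun=> 1) g).
  by apply: eq_bigr => p _; rewrite mul1r.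
rewrite -sE; apply: HL => [p /mapP[q qs ->] /=|y y0]; first exact/g0/s0.
by rewrite /expsum sE; exact: gL.
Qed.

(** The transform of a convolution of measures.  The functional of [L], applied
    to the translates of a nonnegative sum, gives a sum that is again
    nonnegative and whose coefficients are the [a * L l]; the functional of [K]
    is applied to that sum. *)
Lemma laplace_typeM L K : laplace_type L -> laplace_type K ->
  laplace_type (fun l => L l * K l).
Proof.
move=> HL HK s s0 s1.
rewrite -(comb_map s L id); apply: HK => [p /mapP[q qs ->] /=|y y0].
  exact: s0.
rewrite /expsum (comb_map s L id).
under [X in comb s X]eq_fun do rewrite mulrC.
rewrite -(comb_map s (fun l => expR (- (l * y))) id).
apply: HL => [p /mapP[q qs ->] /=|z z0]; first exact: s0.
rewrite /expsum (comb_map s (fun l => expR (- (l * y))) id).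
rewrite (_ : comb _ _ = expsum s (y + z)); first by rewrite s1// addr_ge0.
by rewrite /expsum; congr comb; apply/funext => l; rewrite -expRD; congr expR; ring.
Qed.

Lemma laplace_type_cst k : 0 <= k -> laplace_type (fun=> k).
Proof.
move=> k0; have := laplace_typeZ k0 (laplace_type_exp (lexx 0)).
by apply: eq_laplace_type => l _; rewrite mulr0 oppr0 expR0 mulr1.
Qed.

Lemma laplace_typeX L n : laplace_type L -> laplace_type (fun l => L l ^+ n).
Proof.
move=> HL; elim: n => [|n IH].
  by apply: eq_laplace_type (laplace_type_cst ler01) => l _; rewrite expr0.
by apply: eq_laplace_type (laplace_typeM HL IH) => l _; rewrite exprS.
Qed.

(** The partial sums of the exponential series are polynomials in [L] with
    nonnegative coefficients. *)
Lemma laplace_type_expR L : laplace_type L ->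
  laplace_type (fun l => expR (L l)).
Proof.
move=> HL.
apply: (@laplace_type_cvg (fun n l => series (exp_coeff (L l)) n)); last first.
  by move=> l _; exact: is_cvg_series_exp_coeff.
near=> n; elim: {+}n => [|k IH].
  by apply: eq_laplace_type (laplace_type_cst (lexx 0)) => l _; rewrite /series/= big_nil.
have : laplace_type (fun l => (k`!%:R)^-1 * L l ^+ k).
  by apply: laplace_typeZ; [rewrite invr_ge0|exact: laplace_typeX].
move=> /(laplace_typeD IH); apply: eq_laplace_type => l _.
by rewrite /series/= big_nat_recr//= [exp_coeff _ _]mulrC.
Unshelve. all: end_near. Qed.

Lemma comb_Rintegral d (T : measurableType d) (mu : {measure set T -> \bar R})
  (D : set T) (mD : measurable D) s (f : R -> T -> R) : nneg_exps s ->
  (forall l, 0 <= l -> mu.-integrable D (EFin \o f l)) ->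
  mu.-integrable D (fun u => (comb s (fun l => f l u))%:E) /\
  comb s (fun l => \int[mu]_(u in D) f l u) =
  \int[mu]_(u in D) comb s (fun l => f l u).
Proof.
move=> s0 fi; rewrite /comb; elim: s s0 => [|p s IH] s0.
  split.
    by under eq_fun do rewrite big_nil; exact: integrable0.
  rewrite big_nil; under eq_Rintegral do rewrite big_nil.
  by rewrite Rintegral_cst// mul0r.
have [|i e] := IH; first by move=> q qs; apply: s0; rewrite in_cons qs orbT.
have fpi : mu.-integrable D (EFin \o f p.2) by apply/fi/s0; rewrite mem_head.
have fpi' : mu.-integrable D (EFin \o (fun u => p.1 * f p.2 u)).
  by rewrite (_ : _ \o _ = (fun u => p.1%:E * (f p.2 u)%:E)%E);
    [exact: integrableZl|apply/funext => u /=; rewrite EFinM].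
split.
  under eq_fun do rewrite big_cons EFinD.
  exact: integrableD.
rewrite big_cons e; under [RHS]eq_Rintegral do rewrite big_cons.
by rewrite RintegralD// RintegralZl.
Qed.

Lemma laplace_type_Rintegral d (T : measurableType d)
  (mu : {measure set T -> \bar R}) (D : set T) (mD : measurable D)
  (f : R -> T -> R) :
  (forall l, 0 <= l -> mu.-integrable D (EFin \o f l)) ->
  (forall u, D u -> laplace_type (f ^~ u)) ->
  laplace_type (fun l => \int[mu]_(u in D) f l u).
Proof.
move=> fi fD s s0 s1; have [_ ->] := comb_Rintegral mD s0 fi.
by apply: Rintegral_ge0 => u /fD; exact.
Qed.

Lemma bernstein_laplace_type g y : bernstein g -> 0 <= y ->
  laplace_type (fun l => expR (- (g l * y))).
Proof. by move=> [_ gL] y0; apply: eq_laplace_type (gL _ y0) => l _; rewrite mulrC. Qed.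

Lemma laplace_type_comp L g : bernstein g -> laplace_type L ->
  laplace_type (fun l => L (g l)).
Proof.
move=> gB; apply: laplace_type_subst; first exact: gB.1.
by move=> y; exact: bernstein_laplace_type.
Qed.

Lemma bernstein_comp f g : bernstein f -> bernstein g ->
  bernstein (fun l => f (g l)).
Proof.
move=> fB gB; split=> [l l0|x x0]; first exact/fB.1/gB.1.
exact: (laplace_type_comp gB (fB.2 _ x0)).
Qed.

Lemma bernsteinD f g : bernstein f -> bernstein g ->
  bernstein (fun l => f l + g l).
Proof.
move=> fB gB; split=> [l l0|x x0]; first by rewrite addr_ge0// ?fB.1 ?gB.1.
apply: eq_laplace_type (laplace_typeM (fB.2 _ x0) (gB.2 _ x0)) => l _.
by rewrite -expRD; congr expR; ring.
Qed.

Lemma bernstein_linear k : 0 <= k -> bernstein (fun l => k * l).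
Proof.
move=> k0; split=> [l l0|x x0]; first by rewrite mulr_ge0.
apply: eq_laplace_type (laplace_type_exp (mulr_ge0 x0 k0)) => l _.
by congr (expR _); ring.
Qed.

(** These are the compound Poisson exponents: [exp (- x (k - K))] is the
    constant [exp (- x k)] times the exponential of [x K]. *)
Lemma bernstein_cst_sub k K : laplace_type K -> (forall l, 0 <= l -> K l <= k) ->
  bernstein (fun l => k - K l).
Proof.
move=> HK Kk; split=> [l l0|x x0]; first by rewrite subr_ge0 Kk.
have := laplace_typeM (laplace_type_cst (expR_ge0 (- (x * k))))
  (laplace_type_expR (laplace_typeZ x0 HK)).
by apply: eq_laplace_type => l _; rewrite -expRD; congr expR; ring.
Qed.

Lemma bernstein_cvg (gn : nat -> R -> R) g :
  (\forall n \near \oo, bernstein (gn n)) ->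
  (forall l, 0 <= l -> gn n l @[n --> \oo] --> g l) -> bernstein g.
Proof.
move=> gnB gng; split=> [l l0|x x0].
  apply: (cvgr_to_ge (gng _ l0)).
  by near=> n; apply: (near gnB n _).1.
apply: (@laplace_type_cvg (fun n l => expR (- (x * gn n l)))).
  by near=> n; apply: (near gnB n _).2.
move=> l l0; apply: continuous_cvg; first exact: continuous_expR.
by apply: cvgN; apply: cvgMl_tmp; exact: gng.
Unshelve. all: end_near. Qed.

End exponential_combinations.

(** * The jump kernel exp(-uz) - 1 + uz *)

Section kernel.
Context {R : realType}.
Implicit Types (a u y z : R).

Definition kern z u : R := expR (- (u * z)) - 1 + u * z.

(** The function whose integral is finite in [branching_measure]; it dominates
    the kernel and its increments locally uniformly in [z]. *)
Definition jump_weight u : R := Num.min u (u ^+ 2).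

Lemma kern_ge0 z u : 0 <= kern z u.
Proof. by rewrite /kern; have := expR_ge1Dx (- (u * z)); lra. Qed.

Lemma kernB z z' u :
  kern z' u - kern z u =
  u * (z' - z) - expR (- (u * z)) * (1 - expR (- (u * (z' - z)))).
Proof.
rewrite /kern (_ : - (u * z') = - (u * z) + - (u * (z' - z))); last by ring.
by rewrite expRD; ring.
Qed.

Lemma expRN_itv y : 0 <= y -> 0 <= expR (- y) <= 1.
Proof. by move=> y0; rewrite expR_ge0 -expR0 ler_expR oppr_le0. Qed.

Lemma kern_le z z' u : 0 <= u -> 0 <= z -> z <= z' -> kern z u <= kern z' u.
Proof.
move=> u0 z0 zz'; rewrite -subr_ge0 kernB.
have /andP[e0 e1] := expRN_itv (mulr_ge0 u0 z0).
have := expR_ge1Dx (- (u * (z' - z))).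
have d0 : 0 <= u * (z' - z) by rewrite mulr_ge0// subr_ge0.
have /andP[_ d1] := expRN_itv d0.
nra.
Qed.

(** With [d = u (z' - z)], the difference is [d - exp (- u z) (1 - exp (- d))],
    and [1 - exp (- d) >= d exp (- d)]. *)
Lemma kernB_le z z' u : 0 <= u -> 0 <= z -> z <= z' ->
  kern z' u - kern z u <= u * (z' - z) * (1 - expR (- (u * z'))).
Proof.
move=> u0 z0 zz'; rewrite kernB.
rewrite (_ : expR (- (u * z')) = expR (- (u * z)) * expR (- (u * (z' - z)))).
  2: by rewrite -expRD; congr expR; ring.
set d := u * (z' - z); set e := expR (- (u * z)).
have e0 : 0 <= e by exact: expR_ge0.
suff : d * expR (- d) <= 1 - expR (- d) by nra.
have /andP[d0 _] : 0 <= expR (- d) <= 1.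
  by apply: expRN_itv; rewrite mulr_ge0// subr_ge0.
have := expR_ge1Dx d; have : expR d * expR (- d) = 1 by rewrite -expRD subrr expR0.
nra.
Qed.

Lemma kernB_le_linear z z' u : 0 <= u -> 0 <= z -> z <= z' ->
  kern z' u - kern z u <= u * (z' - z).
Proof.
move=> u0 z0 zz'; apply: (le_trans (kernB_le u0 z0 zz')).
by rewrite ler_piMr ?mulr_ge0 ?subr_ge0// lerBlDr lerDl expR_ge0.
Qed.

Lemma jump_weight_ge0 u : 0 <= u -> 0 <= jump_weight u.
Proof. by move=> u0; rewrite /jump_weight le_min u0 sqr_ge0. Qed.

Lemma kernB_le_weight z z' u : 0 <= u -> 0 <= z -> z <= z' ->
  kern z' u - kern z u <= (z' - z) * (1 + z') * jump_weight u.
Proof.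
move=> u0 z0 zz'; apply: (le_trans (kernB_le u0 z0 zz')).
have d0 : 0 <= z' - z by rewrite subr_ge0.
have z'0 := le_trans z0 zz'.
have /andP[e0 e1] := expRN_itv (mulr_ge0 u0 z'0).
have e2 := expR_ge1Dx (- (u * z')).
rewrite [u * _]mulrC -!mulrA ler_wpM2l// /jump_weight.
have p1 := mulr_ge0 u0 e0; have p2 := mulr_ge0 u0 z'0.
have p3 : 0 <= u * (expR (- (u * z')) - (1 + - (u * z'))).
  by rewrite mulr_ge0// subr_ge0.
by case: (leP u (u ^+ 2)) => _; nra.
Qed.

Lemma kern0 u : kern 0 u = 0.
Proof. by rewrite /kern mulr0 oppr0 expR0; ring. Qed.

Lemma kern_le_weight z u : 0 <= u -> 0 <= z ->
  kern z u <= z * (1 + z) * jump_weight u.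
Proof.
by move=> u0 z0; have := kernB_le_weight u0 (lexx 0) z0; rewrite kern0 !subr0.
Qed.

(** The kernel is convex in [z] and vanishes at [0].  The convexity inequality
    is read off the tangent of the exponential at [a u z]: the two bounds
    [exp (- u z) >= e (1 - (1 - a) u z)] and [1 >= e (1 + a u z)], with
    [e = exp (- a u z)], have barycentre [e]. *)
Lemma kern_star a z u : 0 <= a <= 1 -> kern (a * z) u <= a * kern z u.
Proof.
move=> /andP[a0 a1]; rewrite /kern.
set y := u * z; rewrite [u * (a * z)]mulrCA -/y.
suff : expR (- (a * y)) <= a * expR (- y) + (1 - a) by nra.
set e := expR (- (a * y)).
have e0 : 0 <= e by exact: expR_ge0.
have : e * (1 - (1 - a) * y) <= expR (- y).
  rewrite (_ : - y = - (a * y) + - ((1 - a) * y)); last by ring.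
  by rewrite expRD ler_wpM2l//; have := expR_ge1Dx (- ((1 - a) * y)); lra.
have : e * (1 + a * y) <= 1.
  rewrite [leRHS](_ : 1 = e * expR (a * y)); last by rewrite -expRD addNr expR0.
  by rewrite ler_wpM2l// expR_ge1Dx.
nra.
Qed.

(** The mean value theorem applied to the difference, whose derivative at [y]
    is bounded by [y ^+ 2]. *)
Lemma kern_taylor z u : 0 <= u -> 0 <= z ->
  `|(u * z) ^+ 2 / 2 - kern z u| <= (u * z) ^+ 3.
Proof.
move=> u0 z0; rewrite /kern; set y := u * z; have y0 : 0 <= y by exact: mulr_ge0.
pose f (x : R) : R := x ^+ 2 / 2 - (expR (- x) - 1 + x).
pose df (x : R) : R := x - (1 - expR (- x)).
have fd (x : R) : is_derive x 1 f (df x).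
  rewrite /f /df; apply: is_derive_eq.
  by rewrite /GRing.scale/=; field.
have cf : continuous f.
  by move=> x; apply: differentiable_continuous; apply/derivable1_diffP; case: (fd x).
have [//|x|c] := @MVT_segment _ f df 0 y _ _ _.
  by apply: continuous_subspaceT.
have f0 : f 0 = 0 by rewrite /f oppr0 expR0; field.
rewrite in_itv/= => /andP[c0 cy]; rewrite f0 !subr0 => fE.
rewrite -/(f y) fE /df normrM (ger0_norm y0) exprSr ler_wpM2r//.
have e1 := expR_ge1Dx c; have e2 := expR_ge1Dx (- c).
have : expR c * expR (- c) = 1 by rewrite -expRD subrr expR0.
have := expR_ge0 (- c); rewrite ler_norml; nra.
Qed.

End kernel.

(** The jump measure is the image by [jump] of the measure [m] restricted to
    the set [pos] where [jump] is positive. *)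
Section jump_part.
Context {R : realType} d (T : measurableType d) (m : {measure set T -> \bar R}).
Variable jump : T -> R.
Hypothesis mjump : measurable_fun setT jump.
Let pos : set T := jump @^-1` `]0, +oo[.
Hypothesis mb : (\int[m]_(u in pos) (jump_weight (jump u))%:E < +oo)%E.
Implicit Types (a z : R) (u : T).

Let mpos : measurable pos.
Proof. by rewrite -[pos]setTI; apply: mjump => //; exact: measurable_itv. Qed.

Lemma measurable_jump_weight (D : set T) :
  measurable_fun D (fun u => jump_weight (jump u)).
Proof.
have mj : measurable_fun D jump by exact: measurable_funTS.
by apply: measurable_minr => //; exact: measurable_funX.
Qed.

Lemma measurable_kern (D : set T) z :
  measurable_fun D (fun u => kern z (jump u)).
Proof.
have mj : measurable_fun D jump by exact: measurable_funTS.
apply: measurable_funD; last by apply: measurable_funM.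
apply: measurable_funB => //; apply: measurableT_comp => //.
by apply: measurableT_comp => //; exact: measurable_funM.
Qed.

Lemma integrable_jump_weight : m.-integrable pos (EFin \o (fun u => jump_weight (jump u))).
Proof.
apply/integrableP; split; first by apply/measurable_EFinP; exact: measurable_jump_weight.
rewrite (eq_integral (fun u => (jump_weight (jump u))%:E))// => x.
rewrite inE /pos/= in_itv/= andbT => x0.
by rewrite ger0_norm// jump_weight_ge0// ltW.
Qed.

Variables (D : set T).
Hypotheses (mD : measurable D) (Dpos : D `<=` pos).

Lemma jump_domain_ge0 u : D u -> 0 <= jump u.
Proof. by move=> /Dpos; rewrite /pos/= in_itv/= andbT => /ltW. Qed.

Lemma integrable_jump_weightS : m.-integrable D (EFin \o (fun u => jump_weight (jump u))).
Proof. by exact: integrableS integrable_jump_weight. Qed.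

Definition jump_part z : R := \int[m]_(u in D) kern z (jump u).
Definition jump_mass : R := \int[m]_(u in D) jump_weight (jump u).

Lemma integrable_kern z : 0 <= z -> m.-integrable D (EFin \o (fun u => kern z (jump u))).
Proof.
move=> z0; apply: (@le_integrable _ _ _ _ _ mD _ (fun u => (z * (1 + z))%:E * (jump_weight (jump u))%:E)%E).
- by apply/measurable_EFinP; exact: measurable_kern.
- move=> u /jump_domain_ge0 u0 /=.
  rewrite lee_fin !ger0_norm ?kern_ge0 ?kern_le_weight//.
  by rewrite !mulr_ge0 ?addr_ge0// jump_weight_ge0.
- by apply: integrableZl => //; exact: integrable_jump_weightS.
Qed.

Lemma jump_mass_ge0 : 0 <= jump_mass.
Proof. by apply: Rintegral_ge0 => u /jump_domain_ge0; exact: jump_weight_ge0. Qed.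

Lemma jump_part_le z z' : 0 <= z -> z <= z' -> jump_part z <= jump_part z'.
Proof.
move=> z0 zz'; apply: le_Rintegral => //.
- exact: integrable_kern.
- by apply: integrable_kern; exact: le_trans zz'.
- by move=> u /jump_domain_ge0 u0; exact: kern_le.
Qed.

Lemma jump_partB_le z z' : 0 <= z -> z <= z' ->
  jump_part z' - jump_part z <= (z' - z) * (1 + z') * jump_mass.
Proof.
move=> z0 zz'; have z'0 := le_trans z0 zz'.
rewrite /jump_part /jump_mass -RintegralB//; [|exact: integrable_kern..].
rewrite -RintegralZl//; last exact: integrable_jump_weightS.
apply: le_Rintegral => //.
- apply: (@eq_integrable _ _ _ _ _ mD ((EFin \o (fun u => kern z' (jump u))) \- (EFin \o (fun u => kern z (jump u))))%E) => //.
  by apply: integrableB => //; exact: integrable_kern.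
- apply: (@eq_integrable _ _ _ _ _ mD (fun u => ((z' - z) * (1 + z'))%:E * (jump_weight (jump u))%:E)%E) => //.
  by apply: integrableZl => //; exact: integrable_jump_weightS.
- by move=> u /jump_domain_ge0 u0; exact: kernB_le_weight.
Qed.

Lemma jump_part_le_mass z : 0 <= z -> jump_part z <= z * (1 + z) * jump_mass.
Proof.
move=> z0; have := jump_partB_le (lexx 0) z0.
rewrite {2}/jump_part; under eq_Rintegral do rewrite kern0.
by rewrite Rintegral_cst// mul0r !subr0.
Qed.

Lemma jump_part_ge0 z : 0 <= jump_part z.
Proof. by apply: Rintegral_ge0 => u _; exact: kern_ge0. Qed.

Lemma jump_part_star a z : 0 <= a <= 1 -> 0 <= z ->
  jump_part (a * z) <= a * jump_part z.
Proof.
move=> a01 z0; have /andP[a0 _] := a01.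
rewrite /jump_part -RintegralZl//; last exact: integrable_kern.
apply: le_Rintegral => //.
- by apply: integrable_kern; exact: mulr_ge0.
- apply: (@eq_integrable _ _ _ _ _ mD (fun u => a%:E * (kern z (jump u))%:E)%E) => //.
  by apply: integrableZl => //; exact: integrable_kern.
- by move=> u _; exact: kern_star.
Qed.

End jump_part.

(** * Approximation by mechanisms of finite activity *)

Section approximation.
Context {R : realType} d (T : measurableType d) (m : {measure set T -> \bar R}).
Variable jump : T -> R.
Hypothesis mjump : measurable_fun setT jump.
Let pos : set T := jump @^-1` `]0, +oo[.
Hypothesis mb : (\int[m]_(u in pos) (jump_weight (jump u))%:E < +oo)%E.
Variables b c : R.
Hypothesis c_ge0 : 0 <= c.
Implicit Types (a h z : R) (u : T).

Definition mechanism z : R := b * z + c * z ^+ 2 + jump_part m jump pos z.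

Definition large_jumps n : set T := jump @^-1` `](n.+1%:R^-1), +oo[.
Definition small_jumps n : set T := jump @^-1` `]0, n.+1%:R^-1].

(** Jumps of size at most [1 / (n + 1)] are dropped, and the quadratic term is
    replaced by an atom of mass [2 c (n + 1) ^ 2] at the jump size
    [1 / (n + 1)]. *)
Definition approx_mechanism n z : R :=
  b * z + 2 * c * n.+1%:R ^+ 2 * kern z n.+1%:R^-1
  + jump_part m jump (large_jumps n) z.

(** The derivative at infinity of [approx_mechanism n], that is the supremum of
    its slopes: the drift plus the mean of the jump measure. *)
Definition approx_slope n : R :=
  b + 2 * c * n.+1%:R + \int[m]_(u in large_jumps n) jump u.

Let mpre (i : interval R) : measurable (jump @^-1` [set` i]).
Proof. by rewrite -[jump @^-1` _]setTI; apply: mjump => //; exact: measurable_itv. Qed.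

Let mpos : measurable pos. Proof. exact: mpre. Qed.
Let mlarge n : measurable (large_jumps n). Proof. exact: mpre. Qed.
Let msmall n : measurable (small_jumps n). Proof. exact: mpre. Qed.

Let large_pos n : large_jumps n `<=` pos.
Proof.
move=> u; rewrite /large_jumps /pos/= !in_itv/= !andbT; apply: lt_trans.
by rewrite invr_gt0 ltr0n.
Qed.

Let small_pos n : small_jumps n `<=` pos.
Proof. by move=> u; rewrite /small_jumps /pos/= !in_itv/= andbT => /andP[]. Qed.

Lemma mechanismB_ge z z' : 0 <= z -> z <= z' ->
  b * (z' - z) <= mechanism z' - mechanism z.
Proof.
move=> z0 zz'; have := jump_part_le mjump mb mpos (@subset_refl _ _) z0 zz'.
have : 0 <= c * ((z' + z) * (z' - z)).
  by rewrite !mulr_ge0// ?subr_ge0// addr_ge0// (le_trans z0).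
rewrite /mechanism -/pos; nra.
Qed.

Lemma mechanismB_le z z' : 0 <= z -> z <= z' ->
  mechanism z' - mechanism z <=
  (z' - z) * (b + c * (z' + z) + (1 + z') * jump_mass m jump pos).
Proof.
move=> z0 zz'; have := jump_partB_le mjump mb mpos (@subset_refl _ _) z0 zz'.
rewrite /mechanism -/pos; nra.
Qed.

(** Convexity and the value [0] at the origin, in the only form needed for the
    comparison with Grey's condition. *)
Lemma mechanism_star a z : 0 <= a <= 1 -> 0 <= z ->
  mechanism (a * z) <= a * mechanism z.
Proof.
move=> a01 z0; have := jump_part_star mjump mb mpos (@subset_refl _ _) a01 z0.
have /andP[a0 a1] := a01.
have : 0 <= c * (a * (1 - a) * z ^+ 2).
  by rewrite !mulr_ge0// ?subr_ge0// sqr_ge0.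
rewrite /mechanism -/pos; nra.
Qed.

Lemma large_jumps_ge0 n u : large_jumps n u -> 0 <= jump u.
Proof. by move=> /large_pos; rewrite /pos/= in_itv/= andbT => /ltW. Qed.

Lemma weight_large n u : large_jumps n u ->
  1 <= n.+1%:R ^+ 2 * jump_weight (jump u) /\
  jump u <= n.+1%:R * jump_weight (jump u).
Proof.
rewrite /large_jumps/= in_itv/= andbT => nu.
have n1 : 1 <= n.+1%:R :> R by rewrite ler1n.
have n0 : 0 < n.+1%:R :> R by rewrite ltr0n.
have u1 : 1 < n.+1%:R * jump u by rewrite mulrC -ltr_pdivrMr// mul1r.
rewrite /jump_weight; set x := jump u in u1 *; set N := n.+1%:R in n1 n0 u1 *.
have x0 : 0 < x by rewrite -(pmulr_rgt0 _ n0) (lt_trans ltr01).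
by case: (leP x (x ^+ 2)) => _; split; nra.
Qed.

Lemma integrable_large_jumps n :
  m.-integrable (large_jumps n) (EFin \o (fun=> 1)) /\
  m.-integrable (large_jumps n) (EFin \o jump).
Proof.
have iw := integrable_jump_weightS mjump mb (mlarge n) (@large_pos n).
split.
- apply: (@le_integrable _ _ _ _ _ (mlarge n) _
    (fun u => (n.+1%:R ^+ 2)%:E * (jump_weight (jump u))%:E)%E) => //.
  + by apply/measurable_EFinP; exact: measurable_cst.
  + move=> u lu /=. rewrite lee_fin; have [? _] := weight_large lu.
    by rewrite normr1 (le_trans _ (ler_norm _)).
  + exact: integrableZl.
- apply: (@le_integrable _ _ _ _ _ (mlarge n) _
    (fun u => (n.+1%:R)%:E * (jump_weight (jump u))%:E)%E) => //.
  + by apply/measurable_EFinP; exact: measurable_funTS.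
  + move=> u lu /=; rewrite lee_fin; have [_ ?] := weight_large lu.
    rewrite ger0_norm ?large_jumps_ge0 ?(le_trans _ (ler_norm _))//.
    exact: large_jumps_ge0 lu.
  + exact: integrableZl.
Qed.

Lemma approx_mechanismB_ge n z z' : 0 <= z -> z <= z' ->
  b * (z' - z) <= approx_mechanism n z' - approx_mechanism n z.
Proof.
move=> z0 zz'.
have := jump_part_le mjump mb (mlarge n) (@large_pos n) z0 zz'.
have n0 : 0 <= n.+1%:R^-1 :> R by rewrite invr_ge0.
have : 0 <= 2 * c * n.+1%:R ^+ 2 * (kern z' n.+1%:R^-1 - kern z n.+1%:R^-1).
  by rewrite !mulr_ge0// subr_ge0 kern_le.
rewrite /approx_mechanism; lra.
Qed.

Lemma approx_mechanismB_le n z z' : 0 <= z -> z <= z' ->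
  approx_mechanism n z' - approx_mechanism n z <= approx_slope n * (z' - z).
Proof.
move=> z0 zz'.
have z'0 := le_trans z0 zz'.
have [_ ij] := integrable_large_jumps n.
have jB : jump_part m jump (large_jumps n) z' - jump_part m jump (large_jumps n) z
    <= (z' - z) * \int[m]_(u in large_jumps n) jump u.
  have ik y : 0 <= y -> m.-integrable (large_jumps n) (EFin \o (fun u => kern y (jump u))).
    by move=> y0; apply: integrable_kern y0 => //; exact: large_pos.
  rewrite /jump_part -RintegralB//; [|exact: ik..].
  rewrite -RintegralZl//.
  apply: le_Rintegral => //.
  - rewrite (_ : _ \o _ = (EFin \o (fun u => kern z' (jump u))) \- (EFin \o (fun u => kern z (jump u))))%E//.
    by apply: integrableB => //; exact: ik.
  - rewrite (_ : _ \o _ = (fun u => (z' - z)%:E * (EFin \o jump) u)%E)//.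
    exact: integrableZl.
  - move=> u /large_jumps_ge0 u0; rewrite [leRHS]mulrC; exact: kernB_le_linear.
have n0 : 0 <= n.+1%:R^-1 :> R by rewrite invr_ge0.
have := kernB_le_linear n0 z0 zz'.
have c2 : 0 <= 2 * c * n.+1%:R ^+ 2 by rewrite !mulr_ge0.
move=> /(ler_wpM2l c2).
have N0 : n.+1%:R != 0 :> R by rewrite pnatr_eq0.
rewrite /approx_mechanism /approx_slope; set N := n.+1%:R in N0 *.
rewrite (_ : 2 * c * N ^+ 2 * (N^-1 * (z' - z)) = 2 * c * N * (z' - z)).
  2: by clearbody N; field.
lra.
Qed.

(** Expanding the kernel, the map is the linear map of slope
    [1 - h * approx_slope n] plus a constant minus the Laplace transform [K] of
    the finite jump measure, taken at [w / a]. *)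
Lemma approx_mechanism_bernstein n h a : 0 <= h -> 0 < a ->
  h * approx_slope n <= 1 ->
  bernstein (fun w => w - h * (a * approx_mechanism n (w / a))).
Proof.
move=> h0 a0 hs; have ai0 : 0 <= a^-1 by rewrite invr_ge0 ltW.
have [i1 ij] := integrable_large_jumps n.
pose K z := 2 * c * n.+1%:R ^+ 2 * expR (- (z * n.+1%:R^-1))
  + \int[m]_(u in large_jumps n) expR (- (z * jump u)).
have ie z : 0 <= z ->
    m.-integrable (large_jumps n) (EFin \o (fun u => expR (- (z * jump u)))).
  move=> z0; apply: (le_integrable _ _ _ i1) => //.
    apply/measurable_EFinP; apply: measurableT_comp => //.
    apply: measurableT_comp => //; apply: measurable_funM => //.
    exact: measurable_funTS.
  move=> u /large_jumps_ge0 u0 /=; rewrite lee_fin normr1.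
  by have /andP[e0 e1] := expRN_itv (mulr_ge0 z0 u0); rewrite ger0_norm.
have LK : laplace_type K.
  apply: laplace_typeD.
    apply: laplace_typeZ; first by rewrite !mulr_ge0.
    by apply: laplace_type_exp; rewrite invr_ge0.
  apply: laplace_type_Rintegral => // u /large_jumps_ge0 u0.
  exact: laplace_type_exp.
have bA : bernstein (fun w => a^-1 * w) by exact: bernstein_linear.
have LKa : laplace_type (fun w => h * a * K (a^-1 * w)).
  apply: laplace_typeZ; first by rewrite mulr_ge0// ltW.
  exact: (laplace_type_comp bA).
pose M := \int[m]_(u in large_jumps n) (fun=> 1 : R) u.
have Kle w : 0 <= w -> h * a * K (a^-1 * w) <= h * a * (2 * c * n.+1%:R ^+ 2 + M).
  move=> w0; have z0 : 0 <= a^-1 * w by rewrite mulr_ge0.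
  apply: ler_wpM2l; first by rewrite mulr_ge0// ltW.
  apply: lerD.
    rewrite ler_piMr ?mulr_ge0//.
    have ni : 0 <= n.+1%:R^-1 :> R by rewrite invr_ge0.
    by have /andP[] := expRN_itv (mulr_ge0 z0 ni).
  apply: le_Rintegral => //; first exact: ie.
  by move=> u /large_jumps_ge0 u0; have /andP[] := expRN_itv (mulr_ge0 z0 u0).
have := bernsteinD (@bernstein_linear _ (1 - h * approx_slope n) _)
  (bernstein_cst_sub LKa Kle).
rewrite subr_ge0 => /(_ hs).
have kE z : 0 <= z -> jump_part m jump (large_jumps n) z =
   \int[m]_(u in large_jumps n) expR (- (z * jump u)) - M
   + z * \int[m]_(u in large_jumps n) jump u.
  move=> z0; rewrite /jump_part /kern /M -RintegralZl// -RintegralB//; last exact: ie.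
  rewrite -RintegralD//; last 2 first.
  - rewrite (_ : _ \o _ = (EFin \o (fun u => expR (- (z * jump u)))) \- (EFin \o (fun=> 1%R)))%E//.
    by apply: integrableB => //; exact: ie.
  - rewrite (_ : _ \o _ = (fun u => z%:E * (EFin \o jump) u)%E)//.
    exact: integrableZl.
  by apply: eq_Rintegral => u _; rewrite mulrC.
have E w : 0 <= w -> (1 - h * approx_slope n) * w +
    (h * a * (2 * c * n.+1%:R ^+ 2 + M) - h * a * K (a^-1 * w)) =
    w - h * (a * approx_mechanism n (w / a)).
  move=> w0; rewrite /approx_mechanism /approx_slope kE ?divr_ge0 ?(ltW a0)//.
  rewrite /K /kern [a^-1 * w]mulrC [n.+1%:R^-1 * _]mulrC.
  set J := \int[m]_(u in large_jumps n) jump u.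
  set I := \int[m]_(u in large_jumps n) expR (- (w / a * jump u)).
  set e := expR _.
  have N0 : n.+1%:R != 0 :> R by rewrite pnatr_eq0.
  set N := n.+1%:R in N0 *; have a1 : a != 0 by rewrite gt_eqF.
  clearbody N; by field; rewrite a1 N0.
move=> [B0 B1]; split=> [w w0|x x0]; first by rewrite -E// B0.
by apply: eq_laplace_type (B1 _ x0) => w w0; rewrite E.
Qed.

Lemma small_jumps_mass_cvg0 :
  jump_mass m jump (small_jumps n) @[n --> \oo] --> 0.
Proof.
pose w u := jump_weight (jump u).
have iw : m.-integrable pos (EFin \o w) by exact: integrable_jump_weight.
have mw D : measurable_fun D w by exact: measurable_jump_weight.
have [] := @dominated_convergence _ _ _ m pos mpos
    (fun n u => ((w \_ (small_jumps n)) u)%:E) (fun=> 0%E) (EFin \o w) _ _ _ iw.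
- move=> n; apply/measurable_EFinP; apply/(measurable_restrict _ _ _) => //.
- exact: measurable_cst.
- apply/aeW => u; rewrite /pos/= in_itv/= andbT => u0.
  apply: cvg_near_cst.
  have := near_infty_natSinv_lt (PosNum u0).
  apply: filterS => n /= nu; rewrite patchE ifF//; apply/negbTE.
  by rewrite notin_setE /small_jumps/= in_itv/= u0/= leNgt nu.
- apply/aeW => u n pu; rewrite patchE.
  have w0 : 0 <= w u.
    by apply: jump_weight_ge0; move: pu; rewrite /pos/= in_itv/= andbT => /ltW.
  by case: ifPn => _; rewrite /= ?normr0 ?ger0_norm// lee_fin.
move=> _ _; rewrite integral0 => /fine_cvgP[_] /=; apply: cvg_trans.
apply: near_eq_cvg; near=> n => /=.
rewrite /jump_mass -[in RHS](setIidr (@small_pos n)).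
by rewrite Rintegral_mkcondr.
Unshelve. all: end_near. Qed.

Lemma jump_part_split n z : 0 <= z -> jump_part m jump pos z =
  jump_part m jump (small_jumps n) z + jump_part m jump (large_jumps n) z.
Proof.
move=> z0; have E : pos = small_jumps n `|` large_jumps n.
  apply/seteqP; split=> u; rewrite /pos /small_jumps /large_jumps/= !in_itv/= !andbT.
    by move=> ->/=; case: leP; [left|right].
  by move=> [/andP[]//|]; apply: lt_trans; rewrite invr_gt0 ltr0n.
rewrite /jump_part E Rintegral_setU//.
- by rewrite -E; exact: integrable_kern.
- apply/disj_setPS => u []; rewrite /small_jumps /large_jumps/= !in_itv/= andbT.
  by move=> /andP[_ ul] /(le_lt_trans ul); rewrite ltxx.
Qed.

(** The error is the Taylor remainder of the atom plus the contribution of the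
    small jumps, which is at most [z (1 + z)] times their total weight. *)
Lemma approx_mechanism_cvg k : 0 <= k -> exists2 e : nat -> R,
  e n @[n --> \oo] --> 0 &
  forall n z, 0 <= z <= k -> `|mechanism z - approx_mechanism n z| <= e n.
Proof.
move=> k0.
exists (fun n => 2 * c * k ^+ 3 * n.+1%:R^-1
                 + k * (1 + k) * jump_mass m jump (small_jumps n)).
  rewrite [X in _ --> X](_ : 0 = 2 * c * k ^+ 3 * 0 + k * (1 + k) * 0); last by ring.
  apply: cvgD; apply: cvgMl_tmp; last exact: small_jumps_mass_cvg0.
  exact: cvg_harmonic.
move=> n z /andP[z0 zk].
have n0 : 0 <= n.+1%:R^-1 :> R by rewrite invr_ge0.
rewrite /mechanism -/pos (jump_part_split n z0) /approx_mechanism.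
have -> : b * z + c * z ^+ 2 +
    (jump_part m jump (small_jumps n) z + jump_part m jump (large_jumps n) z)
    - (b * z + 2 * c * n.+1%:R ^+ 2 * kern z n.+1%:R^-1
       + jump_part m jump (large_jumps n) z)
  = 2 * c * n.+1%:R ^+ 2 * ((n.+1%:R^-1 * z) ^+ 2 / 2 - kern z n.+1%:R^-1)
    + jump_part m jump (small_jumps n) z.
  have N0 : n.+1%:R != 0 :> R by rewrite pnatr_eq0.
  move: (kern _ _) => K; set N := n.+1%:R in N0 *; clearbody N; by field.
apply: (le_trans (ler_normD _ _)); apply: lerD.
  rewrite normrM ger0_norm ?mulr_ge0//.
  have c2 : 0 <= 2 * c * n.+1%:R ^+ 2 by rewrite !mulr_ge0.
  apply: (le_trans (ler_wpM2l c2 (kern_taylor n0 z0))).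
  rewrite [leLHS](_ : _ = 2 * c * z ^+ 3 * n.+1%:R^-1).
    rewrite ler_wpM2r// ler_wpM2l ?mulr_ge0//.
    by rewrite lerXn2r// nnegrE// (le_trans z0).
  have N0 : n.+1%:R != 0 :> R by rewrite pnatr_eq0.
  set N := n.+1%:R in N0 *; clearbody N; by field.
rewrite ger0_norm ?jump_part_ge0//.
apply: (le_trans (jump_part_le_mass mjump mb (msmall n) (@small_pos n) z0)).
apply: ler_wpM2r; first by apply: jump_mass_ge0 (@small_pos n).
by rewrite ler_pM// ?addr_ge0// lerD2l.
Qed.

End approximation.

(** * Cadlag paths and Riemann sums *)

Section right_continuity.
Context {R : realType}.
Implicit Types (f g x : R -> R) (s t : R).

(** Sequential form, in which [r] may return to [s]: the grid points used below
    can coincide with [s]. *)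
Definition right_continuous_upto t f : Prop :=
  forall s (r : nat -> R), 0 <= s < t -> (forall n, s <= r n <= t) ->
    r n @[n --> \oo] --> s -> f (r n) @[n --> \oo] --> f s.

Lemma cadlag_right_continuous x t : cadlag x -> right_continuous_upto t x.
Proof.
move=> [xr _] s r /andP[s0 st] rst rs.
apply: (@cvg_comp _ _ _ r x \oo (within (fun u => s <= u) (nbhs s))); last first.
  by apply: cvg_at_right_within; exact: xr.
move=> A /= /rs; rewrite /nbhs/=; apply: filterS => n /=; apply.
by have /andP[] := rst n.
Qed.

(** One-sided limits bound the path near each point; compactness of [[0, t]]
    makes the bound uniform. *)
Lemma cadlag_bounded x t : cadlag x ->
  exists k, forall s, 0 <= s <= t -> `|x s| <= k.
Proof.
move=> [xr xl].
have /compact_near_coveringP cp := @segment_compact R 0 t.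
have := cp R (pinfty_nbhs R) (fun i s => 0 <= s -> `|x s| <= i).
case=> [s /=|k [kr kP]]; last first.
  exists (k + 1) => s s0t; apply: (kP (k + 1)); first by rewrite ltrDl.
    by rewrite /= in_itv.
  by case/andP: s0t.
rewrite in_itv/= => /andP[s0 st].
have bdR : exists2 e, 0 < e & forall y, s <= y < s + e -> `|x y| <= `|x s| + 1.
  have /cvgrPdist_lt/(_ 1 ltr01) := xr s s0.
  rewrite near_withinE /= => -[e /= e0 eP].
  exists e => // y /andP[sy ye]; move: sy; rewrite le_eqVlt => /predU1P[<-|sy].
    by rewrite lerDl.
  have := eP y; rewrite /= distrC ger0_norm ?subr_ge0 ?(ltW sy)// ltrBlDl.
  move=> /(_ ye sy) d1; rewrite -[x y](subrK (x s)) addrC.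
  by rewrite (le_trans (ler_normD _ _))// lerD2l distrC ltW.
have bdL : exists2 e, 0 < e &
    exists k, forall y, s - e < y < s -> 0 <= y -> `|x y| <= k.
  move: s0; rewrite le_eqVlt => /predU1P[<-|s0].
    exists 1 => //; exists 0 => y /andP[_ y0] /(lt_le_trans y0).
    by rewrite ltxx.
  have /cvg_ex[l] := xl s s0.
  move=> /cvgrPdist_lt/(_ 1 ltr01); rewrite near_withinE /= => -[e /= e0 eP].
  exists e => //; exists (`|l| + 1) => y /andP[sy ye] _.
  have := eP y; rewrite /= ger0_norm ?subr_ge0 ?(ltW ye)// ltrBlDl -ltrBlDr.
  move=> /(_ sy ye) d1; rewrite -[x y](subrK l) addrC.
  by rewrite (le_trans (ler_normD _ _))// lerD2l distrC ltW.
have [e1 e10 b1] := bdR; have [e2 e20 [k b2]] := bdL.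
exists (ball s (Num.min e1 e2), [set i | Num.max (`|x s| + 1) k < i]) => /=.
  split; first by apply: nbhsx_ballx; rewrite lt_min e10.
  exists (Num.max (`|x s| + 1) k); split => //.
  by rewrite realE; case: (leP 0 (Num.max (`|x s| + 1) k)) => // /ltW ->; rewrite orbT.
move=> [y i] /= []; rewrite /ball/= /ball_/= gt_max lt_min.
move=> /andP[d1 d2] /andP[i1 i2] y0.
have [sy|ys] := leP s y.
  apply: (le_trans (b1 y _)); last exact: ltW.
  by move: d1; rewrite sy distrC ger0_norm ?subr_ge0// ltrBlDl.
apply: (le_trans (b2 y _ y0)); last exact: ltW.
by move: d2; rewrite ys andbT ger0_norm ?subr_ge0 ?(ltW ys)// ltrBlDl -ltrBlDr.
Qed.

End right_continuity.

Section riemann_sums.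
Context {R : realType}.
Notation mu := (@lebesgue_measure R).
Variables (t : R) (g : R -> R).
Hypothesis (gi : mu.-integrable `[0, t] (EFin \o g)).
Hypothesis gr : right_continuous_upto t g.
Variable k : R.
Hypothesis gk : forall s, 0 <= s <= t -> `|g s| <= k.

(** The first point at or after [s] of the grid of mesh [h] that is counted
    backwards from [t]. *)
Definition grid_right h s : R := t - h * (Num.floor ((t - s) / h))%:~R.

Lemma grid_right_itv h s : 0 < h -> 0 <= s <= t ->
  [/\ s <= grid_right h s, grid_right h s < s + h & grid_right h s <= t].
Proof.
move=> h0 /andP[s0 st]; rewrite /grid_right.
have /andP[f1 f2] := floor_itv ((t - s) / h).
have f0 : 0 <= (Num.floor ((t - s) / h))%:~R :> R.
  by rewrite ler0z floor_ge0 divr_ge0// ?subr_ge0// ltW.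
move: f1 f2 f0; rewrite intrD; set q := _%:~R; rewrite ler_pdivlMr// ltr_pdivrMr//.
move=> f1 f2 f0; split; nra.
Qed.

(** A bounded right-continuous function is the pointwise limit of its values at
    the next grid point, so dominated convergence applies. *)
Lemma riemann_error_cvg (h : nat -> R) : (forall n, 0 < h n) ->
  h n @[n --> \oo] --> 0 ->
  (forall n, mu.-integrable `[0, t] (EFin \o (fun s => `|g s - g (grid_right (h n) s)|)))
  /\ \int[mu]_(s in `[0, t]) `|g s - g (grid_right (h n) s)| @[n --> \oo] --> 0.
Proof.
move=> h0 hcv.
have mg : measurable_fun `[0, t] g by apply/measurable_EFinP; case/integrableP: gi.
have mgt : measurable_fun setT (g \_ `[0, t]).
  exact: (measurable_restrictT g (measurable_itv `[0, t])).1.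
have mgr n : measurable_fun setT (grid_right (h n)).
  apply: measurable_funB => //; apply: measurable_funM => //.
  apply: (@measurableT_comp _ _ _ _ _ _ (fun y : R => (Num.floor y)%:~R : R)).
    apply: nondecreasing_measurable => // y z yz.
    by rewrite ler_int le_floor.
  by apply: measurable_funM => //; exact: measurable_funB.
have mgg n : measurable_fun `[0, t] (fun s => `|g s - g (grid_right (h n) s)|).
  apply: measurableT_comp => //; apply: measurable_funB => //.
  apply: (@eq_measurable_fun _ _ _ _ _ ((g \_ `[0, t]) \o grid_right (h n))).
    move=> s; rewrite inE/= in_itv/= => s0t.
    have [a1 a2 a3] := grid_right_itv (h0 n) s0t.
    rewrite patchE ifT// inE/= in_itv/= a3 andbT (le_trans _ a1)//.
    by case/andP: s0t.
  by apply: measurableT_comp => //; exact: measurable_funTS.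
have gg s n : 0 <= s <= t -> `|g s - g (grid_right (h n) s)| <= 2 * k.
  move=> s0t; rewrite (le_trans (ler_normB _ _))// mulrDl mul1r lerD ?gk//.
  have [a1 a2 a3] := grid_right_itv (h0 n) s0t.
  by rewrite a3 andbT (le_trans _ a1)//; case/andP: s0t.
have ik : mu.-integrable `[0, t] (EFin \o (fun=> 2 * k)).
  apply: (@measurable_bounded_integrable _ _ _ mu (fun=> 2 * k)) => //.
  - by rewrite /= lebesgue_measure_itv/=; case: ifP => // _; rewrite ltry.
  - by apply: bounded_cst.
split.
  move=> n; apply: (le_integrable _ _ _ ik) => //; first by apply/measurable_EFinP; exact: mgg.
  move=> s; rewrite /= in_itv/= => s0t; rewrite lee_fin normr_id.
  by rewrite (le_trans (gg _ _ s0t))// ler_norm.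
have [] := @dominated_convergence _ _ _ mu `[0, t] (measurable_itv _)
  (fun n s => `|g s - g (grid_right (h n) s)|%:E) (fun=> 0%E) (EFin \o (fun=> 2 * k)) _ _ _ ik.
- by move=> n; apply/measurable_EFinP; exact: mgg.
- exact: measurable_cst.
(* The point [t] is excepted since right continuity is only known before it. *)
- exists [set t]; split; first exact: measurable_set1.
    exact: lebesgue_measure_set1.
  move=> s /= /not_implyP[]; rewrite in_itv/= => /andP[s0 st] nc.
  apply: contrapT => st'; apply: nc.
  have {}st : s < t by rewrite lt_neqAle st andbT; apply/eqP.
  have s0t : 0 <= s <= t by rewrite s0 ltW.
  apply: cvg_EFin; first by near=> n.
  rewrite [X in _ --> X](_ : 0 = `|g s - g s|); last by rewrite subrr normr0.
  apply: cvg_norm; apply: cvgB; first exact: cvg_cst.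
  apply: gr; first by rewrite s0.
    by move=> n; have [-> _ ->] := grid_right_itv (h0 n) s0t.
  apply: (@squeeze_cvgr _ _ _ _ (fun=> s) (fun n => s + h n)).
  - by near=> n; have [-> /ltW -> _] := grid_right_itv (h0 n) s0t.
  - exact: cvg_cst.
  - by rewrite -[X in _ --> X]addr0; apply: cvgD => //; exact: cvg_cst.
- apply/aeW => s n; rewrite /= in_itv/= => s0t; rewrite lee_fin normr_id.
  exact: gg.
by move=> _ _; rewrite integral0 => /fine_cvgP[_].
Unshelve. all: end_near. Qed.

End riemann_sums.

(** * Solutions of the cumulant equation along a path *)

Section cumulant_paths.
Context {R : realType}.
Notation mu := (@lebesgue_measure R).

Definition locally_lipschitz (phi : R -> R) : Prop := forall k, 0 <= k ->
  exists2 C, 0 <= C & forall z z', 0 <= z <= k -> 0 <= z' <= k ->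
    `|phi z' - phi z| <= C * `|z' - z|.

Variables (phi : R -> R) (x : R -> R) (t lam : R) (v : R -> R).
Hypotheses (phi_lip : locally_lipschitz phi) (cx : cadlag x) (t_gt0 : 0 < t).
Hypotheses (lam_ge0 : 0 <= lam) (vP : cumulant_solution phi x t lam v).

(** After multiplication by [exp (x r)] the cumulant equation says that
    [flow_mass] has derivative [flow_rate]. *)
Definition flow_rate s : R := expR (x s) * phi (v s).
Definition flow_mass s : R := expR (x s) * v s.

Lemma integrable_flow_rate r s : 0 <= r -> s <= t ->
  mu.-integrable `[r, s] (EFin \o flow_rate).
Proof.
move=> r0 st; have [_ gi _] := vP; apply: integrableS gi => //.
by apply: subset_itvScc; rewrite bnd_simp.
Qed.

Lemma flow_massE r : 0 <= r <= t ->
  flow_mass r = expR (x t) * lam - \int[mu]_(s in `[r, t]) flow_rate s.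
Proof.
move=> /[dup] r0t /andP[r0 rt]; have [_ _ vE] := vP.
rewrite /flow_mass vE// mulrBr mulrA -expRD [x r + _]addrC subrK; congr (_ - _).
rewrite -RintegralZl//.
  apply: eq_Rintegral => s _.
  by rewrite mulrA -expRD [x r + _]addrC subrK.
rewrite (_ : _ \o _ = (fun s => (expR (- x r))%:E * (EFin \o flow_rate) s)%E).
  by apply: integrableZl => //; exact: integrable_flow_rate.
apply/funext => s /=; rewrite -EFinM /flow_rate mulrA -expRD.
by rewrite [x s - _]addrC.
Qed.

Lemma flow_massB r s : 0 <= r -> r <= s -> s <= t ->
  flow_mass s - flow_mass r = \int[mu]_(q in `[r, s]) flow_rate q.
Proof.
move=> r0 rs st; rewrite !flow_massE ?r0 ?st ?(le_trans rs) ?(le_trans r0)//.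
have irt := integrable_flow_rate r0 (lexx t).
have := @Rintegral_itvB _ flow_rate (BLeft r) (BRight t) s irt.
rewrite !bnd_simp => /(_ rs st) E1.
have E2 : \int[mu]_(q in `]s, t]) flow_rate q = \int[mu]_(q in `[s, t]) flow_rate q.
  apply: Rintegral_itv_obnd_cbnd; apply: integrableS irt => //.
  by apply: subset_itvScc; rewrite bnd_simp.
lra.
Qed.

(** The integrability of [flow_rate] bounds [flow_mass]; as the path [x] is
    bounded, so is [v], and then [flow_rate] because [phi] is bounded on
    compact sets. *)
Lemma flow_bounded : exists2 k, 0 <= k & forall s, 0 <= s <= t ->
  [/\ expR (x s) <= k, v s <= k & `|flow_rate s| <= k].
Proof.
have [kx xk] := cadlag_bounded t cx.
have [v0 _ _] := vP.
have ig : mu.-integrable `[0, t] (EFin \o flow_rate) by exact: integrable_flow_rate.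
pose kw := expR (x t) * lam + \int[mu]_(s in `[0, t]) `|flow_rate s|.
have wk s : 0 <= s <= t -> `|flow_mass s| <= kw.
  move=> /[dup] s0t /andP[s0 st]; rewrite flow_massE// (le_trans (ler_normB _ _))//.
  rewrite ger0_norm ?mulr_ge0 ?expR_ge0// lerD2l.
  apply: (le_trans (le_normr_Rintegral _ _)) => //.
    exact: integrable_flow_rate.
  rewrite /Rintegral fine_le//.
  - apply: integrable_fin_num => //.
    by apply: integrable_norm; exact: integrable_flow_rate.
  - apply: integrable_fin_num => //; exact: integrable_norm.
  - apply: ge0_subset_integral => //.
      apply: measurableT_comp => //; apply: measurableT_comp => //.
      by apply/measurable_EFinP; case/integrableP: ig.
    by apply: subset_itvScc; rewrite bnd_simp.
have kw0 : 0 <= kw by rewrite (le_trans _ (wk 0 _))// lexx ltW.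
pose kv := expR kx * kw.
have kv0 : 0 <= kv by rewrite mulr_ge0 ?expR_ge0.
have vk s : 0 <= s <= t -> v s <= kv.
  move=> s0t; rewrite (_ : v s = expR (- x s) * flow_mass s); last first.
    by rewrite /flow_mass mulrA -expRD addNr expR0 mul1r.
  rewrite ler_pM ?expR_ge0//.
  - by rewrite mulr_ge0 ?expR_ge0// v0.
  - by rewrite ler_expR lerNl; have := xk _ s0t; rewrite ler_norml => /andP[].
  - by rewrite (le_trans (ler_norm _))// wk.
have [C C0 CP] := phi_lip kv0.
have pk s : 0 <= s <= t -> `|phi (v s)| <= `|phi 0| + C * kv.
  move=> s0t; rewrite -[phi (v s)](subrK (phi 0)) addrC.
  rewrite (le_trans (ler_normD _ _))// lerD2l.
  rewrite (le_trans (CP 0 (v s) _ _))// ?lexx ?v0 ?vk//.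
  by rewrite subr0 ler_wpM2l// ger0_norm ?vk ?v0.
exists (Num.max (Num.max (expR kx) kv) (expR kx * (`|phi 0| + C * kv))).
  by rewrite !le_max expR_ge0.
move=> s s0t.
have ek : expR (x s) <= expR kx.
  by rewrite ler_expR (le_trans (ler_norm _))// xk.
rewrite !le_max ek vk// !orbT /=; split=> //.
rewrite [X in _ || X](_ : _ = true) ?orbT//.
by rewrite normrM ger0_norm ?expR_ge0// ler_pM ?expR_ge0// pk.
Qed.

Lemma flow_rate_right_continuous : right_continuous_upto t flow_rate.
Proof.
have [k k0 kP] := flow_bounded; have [v0 _ _] := vP.
move=> s r /[dup] s0t /andP[s0 st] rst rs.
have r0t n : 0 <= r n <= t.
  by have /andP[sr ->] := rst n; rewrite (le_trans s0 sr).
have s0t' : 0 <= s <= t by rewrite s0 ltW.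
have xr : x (r n) @[n --> \oo] --> x s by apply: (cadlag_right_continuous cx s0t rst).
have wr : flow_mass (r n) @[n --> \oo] --> flow_mass s.
  apply/cvgrPdist_le => e e0.
  have : (fun n => k * `|s - r n|) @ \oo --> (0 : R).
    rewrite [X in _ --> X](_ : 0 = k * `|s - s|); last by rewrite subrr normr0 mulr0.
    by apply: cvgMl_tmp; apply: cvg_norm; apply: cvgB => //; exact: cvg_cst.
  move=> /cvgrPdist_le/(_ _ e0); apply: filterS => n.
  rewrite sub0r normrN ger0_norm ?mulr_ge0//; apply: le_trans.
  have /andP[sr rt] := rst n.
  rewrite distrC flow_massB// (le_trans (le_normr_Rintegral _ _))//.
    exact: integrable_flow_rate.
  have -> : k * `|s - r n| = \int[mu]_(q in `[s, r n]) (fun=> k) q.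
    rewrite Rintegral_cst//= lebesgue_measure_itv/= lte_fin distrC.
    move: sr; rewrite le_eqVlt => /predU1P[->|sr].
      by rewrite subrr normr0 ltxx.
    by rewrite sr/= ger0_norm// subr_ge0 ltW.
  apply: le_Rintegral => //.
  - by apply: integrable_norm; exact: integrable_flow_rate.
  - apply: (@measurable_bounded_integrable _ _ _ mu (fun=> k)) => //.
    + by rewrite /= lebesgue_measure_itv/=; case: ifP => // _; rewrite ltry.
    + by apply: bounded_cst.
  - move=> q; rewrite /= in_itv/= => /andP[sq qr].
    by have [|_ _ //] := kP q; rewrite (le_trans s0 sq) (le_trans qr rt).
have vE q : v q = expR (- x q) * flow_mass q.
  by rewrite /flow_mass mulrA -expRD addNr expR0 mul1r.
have vr : v (r n) @[n --> \oo] --> v s.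
  rewrite vE; under eq_fun do rewrite vE.
  apply: cvgM => //; apply: continuous_cvg; first exact: continuous_expR.
  exact: cvgN.
rewrite /flow_rate; apply: cvgM.
  by apply: continuous_cvg => //; exact: continuous_expR.
have [C C0 CP] := phi_lip k0.
apply/cvgrPdist_le => e e0.
have : (fun n => C * `|v s - v (r n)|) @ \oo --> (0 : R).
  rewrite [X in _ --> X](_ : 0 = C * `|v s - v s|); last by rewrite subrr normr0 mulr0.
  by apply: cvgMl_tmp; apply: cvg_norm; apply: cvgB => //; exact: cvg_cst.
move=> /cvgrPdist_le/(_ _ e0); apply: filterS => n.
rewrite sub0r normrN ger0_norm ?mulr_ge0//; apply: le_trans.
by apply: CP; rewrite v0//=; [have [] := kP _ (r0t n)|have [] := kP _ s0t'].
Qed.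

End cumulant_paths.

(** * The backward Euler scheme *)

Section euler_scheme.
Context {R : realType}.
Notation mu := (@lebesgue_measure R).

(** One backward step of size [h] for the equation satisfied by [flow_mass],
    the environment being frozen at [ln a]. *)
Definition euler_map (psi : R -> R) h a w : R := w - h * (a * psi (w / a)).

(** Step [i] uses the environment at the right end [t - h i] of the interval
    that it crosses. *)
Fixpoint euler (psi x : R -> R) t h w0 (j : nat) : R :=
  if j is i.+1 then
    euler_map psi h (expR (x (t - h * i%:R))) (euler psi x t h w0 i)
  else w0.

Definition slopes_between (b beta : R) (psi : R -> R) : Prop :=
  forall z z', 0 <= z -> z <= z' ->
    b * (z' - z) <= psi z' - psi z <= beta * (z' - z).

(** The increment of the map over [d = w' - w] lies between [0], thanks to
    [h * beta <= 1], and [(1 - h b) d]: only the lower slope of [psi] enters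
    the Lipschitz constant. *)
Lemma euler_map_lipschitz b beta psi h a w w' : slopes_between b beta psi ->
  0 <= h -> 0 < a -> h * beta <= 1 -> 0 <= w -> 0 <= w' ->
  `|euler_map psi h a w' - euler_map psi h a w| <= (1 + h * `|b|) * `|w' - w|.
Proof.
move=> ps h0 a0 hb w0 w'0.
wlog ww' : w w' w0 w'0 / w <= w'.
  by move=> H; have [|/ltW] := leP w w'; [|rewrite distrC (distrC w')]; exact: H.
have ai : 0 <= a^-1 by rewrite invr_ge0 ltW.
have /andP[p1 p2] := ps (w / a) (w' / a) (mulr_ge0 w0 ai) (ler_wpM2r ai ww').
have E : euler_map psi h a w' - euler_map psi h a w =
  (w' - w) - h * (a * (psi (w' / a) - psi (w / a))) by rewrite /euler_map; ring.
have d0 : 0 <= w' - w by rewrite subr_ge0.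
have da : a * (w' / a - w / a) = w' - w by field; rewrite gt_eqF.
have {}p1 : b * (w' - w) <= a * (psi (w' / a) - psi (w / a)).
  by rewrite -da mulrCA ler_pM2l.
have {}p2 : a * (psi (w' / a) - psi (w / a)) <= beta * (w' - w).
  by rewrite -[in leRHS]da [leRHS]mulrCA ler_pM2l.
rewrite (ger0_norm d0) E.
have h1 := ler_wpM2l h0 p1; have h2 := ler_wpM2l h0 p2.
have bb : - `|b| <= b by rewrite lerNl -normrN ler_norm.
have h3 : - (h * `|b| * (w' - w)) <= h * (b * (w' - w)).
  rewrite mulrA -mulNr -mulrN ler_wpM2r// ler_wpM2l//.
have h4 : h * beta * (w' - w) <= 1 * (w' - w) by rewrite ler_wpM2r.
by rewrite ger0_norm; lra.
Qed.

Variables (phi : R -> R) (x : R -> R) (t lam : R) (v : R -> R).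
Hypotheses (t_gt0 : 0 < t) (vP : cumulant_solution phi x t lam v).
Let g := flow_rate phi x v.
Let W := flow_mass x v.

Section error.
Variables (psi : R -> R) (b beta h k eps : R) (N : nat).
Hypotheses (psi_slope : slopes_between b beta psi) (h_gt0 : 0 < h).
Hypotheses (hN : h * N%:R = t) (h_beta : h * beta <= 1).
Hypotheses (xk : forall s, 0 <= s <= t -> expR (x s) <= k).
Hypotheses (vk : forall s, 0 <= s <= t -> v s <= k).
Hypotheses (phi_psi : forall z, 0 <= z <= k -> `|phi z - psi z| <= eps).
Let e := euler psi x t h (expR (x t) * lam).
Hypothesis euler_ge0 : forall j, (j <= N)%N -> 0 <= e j.
Let D s := `|g s - g (grid_right t h s)|.
Hypothesis Di : mu.-integrable `[0, t] (EFin \o D).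

Lemma grid_right_const j s :
  s \in `](t - h * j.+1%:R), (t - h * j%:R)] ->
  grid_right t h s = t - h * j%:R.
Proof.
rewrite in_itv/= => /andP[s1 s2]; rewrite /grid_right.
rewrite (@floor_def _ _ j%:Z)// ler_pdivlMr// ltr_pdivrMr//.
move: s1; rewrite -natr1 intrD !pmulrn; set J := j%:~R; lra.
Qed.

(** The exact increment is the integral of the rate [g] over the step; the Euler
    map uses the value of the rate at the right end, with [psi] instead of
    [phi]. *)
Lemma euler_local_error j : (j < N)%N ->
  `|W (t - h * j.+1%:R) - euler_map psi h (expR (x (t - h * j%:R))) (W (t - h * j%:R))|
  <= \int[mu]_(s in `[(t - h * j.+1%:R), (t - h * j%:R)]) D s + h * (k * eps).
Proof.
move=> jN; have [v0 _ _] := vP.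
set r := t - h * j.+1%:R; set s := t - h * j%:R.
have r0 : 0 <= r.
  by rewrite /r subr_ge0 -hN ler_pM2l// ler_nat.
have srh : s = r + h by rewrite /s /r -natr1; ring.
have rs : r < s by rewrite srh ltrDl.
have st : s <= t by rewrite /s lerBlDr lerDl mulr_ge0// ltW.
have s0t : 0 <= s <= t by rewrite st (le_trans r0 (ltW rs)).
have WB : W s - W r = \int[mu]_(q in `[r, s]) g q.
  by apply: (flow_massB vP) => //; exact: ltW.
have irs : mu.-integrable `[r, s] (EFin \o g) by exact: (integrable_flow_rate vP).
have ic (c : R) : mu.-integrable `[r, s] (EFin \o (fun=> c)).
  apply: (@measurable_bounded_integrable _ _ _ mu (fun=> c)) => //.
  - by rewrite /= lebesgue_measure_itv/=; case: ifP => // _; rewrite ltry.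
  - by apply: bounded_cst.
have Ic (c : R) : \int[mu]_(q in `[r, s]) (fun=> c) q = h * c.
  rewrite Rintegral_cst//= lebesgue_measure_itv/= lte_fin rs/= srh.
  by rewrite addrAC subrr add0r mulrC.
have Es : euler_map psi h (expR (x s)) (W s) = W s - h * (expR (x s) * psi (v s)).
  rewrite /euler_map /W /flow_mass [_ / _]mulrAC mulfV ?mul1r//.
  by rewrite gt_eqF// expR_gt0.
have -> : W r - euler_map psi h (expR (x s)) (W s) =
   - (\int[mu]_(q in `[r, s]) g q - h * g s)
   - h * (expR (x s) * (phi (v s) - psi (v s))).
  by rewrite Es -WB /g /flow_rate; ring.
rewrite (le_trans (ler_normB _ _))// normrN lerD//; last first.
  rewrite normrM (ger0_norm (ltW h_gt0)) ler_pM2l// normrM ger0_norm ?expR_ge0//.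
  by rewrite ler_pM ?expR_ge0 ?xk ?phi_psi// v0// vk.
rewrite -Ic -RintegralB//.
have iB : mu.-integrable `[r, s] (EFin \o (fun q => g q - g s)).
  rewrite (_ : _ \o _ = (EFin \o g) \- (EFin \o (fun=> g s)))%E//.
  by apply: integrableB => //; exact: ic.
apply: (le_trans (le_normr_Rintegral _ iB)) => //.
have iD : mu.-integrable `[r, s] (EFin \o D).
  by apply: integrableS Di => //; apply: subset_itvScc; rewrite bnd_simp.
have sub : `]r, s] `<=` `[r, s] by exact: subset_itv_oc_cc.
rewrite -Rintegral_itv_obnd_cbnd; last first.
  by apply: integrableS (integrable_norm iB) => //.
rewrite -[leRHS]Rintegral_itv_obnd_cbnd; last exact: integrableS iD.
rewrite le_eqVlt; apply/orP; left; apply/eqP.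
apply: eq_Rintegral => q; rewrite inE => /= qrs.
by rewrite /D (grid_right_const qrs).
Qed.

(** Discrete Gronwall inequality: each step multiplies the error by at most
    [1 + h |b|] and adds the local error. *)
Lemma euler_error j : (j <= N)%N ->
  `|e j - W (t - h * j%:R)| <= (1 + h * `|b|) ^+ j *
    (\int[mu]_(s in `[(t - h * j%:R), t]) D s + j%:R * (h * (k * eps))).
Proof.
have [v0 _ _] := vP.
elim: j => [_|j IH jN].
  rewrite mulr0 subr0 expr0 mul1r set_itv1 Rintegral_set1 mul0r addr0.
  rewrite /W (flow_massE vP); last by rewrite lexx ltW.
  by rewrite set_itv1 Rintegral_set1 subr0 /e/= subrr normr0.
have {IH} := IH (ltnW jN).
have eL := euler_local_error jN.
set r := t - h * j.+1%:R in eL *; set s := t - h * j%:R in eL *.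
have r0 : 0 <= r by rewrite /r subr_ge0 -hN ler_pM2l// ler_nat.
have srh : s = r + h by rewrite /s /r -natr1; ring.
have rs : r < s by rewrite srh ltrDl.
have st : s <= t by rewrite /s lerBlDr lerDl mulr_ge0// ltW.
have s0t : 0 <= s <= t by rewrite st (le_trans r0 (ltW rs)).
have irt : mu.-integrable `[r, t] (EFin \o D).
  by apply: integrableS Di => //; apply: subset_itvScc; rewrite bnd_simp.
have DE : \int[mu]_(q in `[r, t]) D q =
    \int[mu]_(q in `[r, s]) D q + \int[mu]_(q in `[s, t]) D q.
  have := @Rintegral_itvB _ D (BLeft r) (BRight t) s irt.
  rewrite !bnd_simp => /(_ (ltW rs) st) E1.
  have E2 : \int[mu]_(q in `]s, t]) D q = \int[mu]_(q in `[s, t]) D q.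
    apply: Rintegral_itv_obnd_cbnd; apply: integrableS irt => //.
    by apply: subset_itvScc => //; rewrite bnd_simp; exact: ltW.
  lra.
have D0 : 0 <= \int[mu]_(q in `[r, s]) D q.
  by apply: Rintegral_ge0 => q _; exact: normr_ge0.
have ws : 0 <= W s by rewrite mulr_ge0 ?expR_ge0// v0.
have eS := euler_map_lipschitz psi_slope (ltW h_gt0) (expR_gt0 (x s)) h_beta
  ws (euler_ge0 (ltnW jN)).
have k0 : 0 <= k by rewrite (le_trans (expR_ge0 (x s)))// xk.
have eps0 : 0 <= eps.
  by rewrite (le_trans (normr_ge0 _) (phi_psi (_ : 0 <= 0 <= k)))// lexx.
set B := 1 + h * `|b| in eS *.
have B1 : 1 <= B by rewrite /B lerDl mulr_ge0// ltW.
set L := \int[mu]_(q in `[s, t]) D q; set M := \int[mu]_(q in `[r, s]) D q in eL DE D0 *.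
set E := h * (k * eps) in eL *.
have E0 : 0 <= E by rewrite !mulr_ge0// ltW.
move=> IH; rewrite DE -/L.
rewrite (_ : e j.+1 = euler_map psi h (expR (x s)) (e j))//.
have : `|euler_map psi h (expR (x s)) (e j) - W r| <= B * `|e j - W s| + (M + E).
  rewrite -[X in `|X - _|](subrK (euler_map psi h (expR (x s)) (W s))) -addrA.
  by rewrite (le_trans (ler_normD _ _))// lerD// distrC.
move=> /le_trans; apply.
have B0 : 0 <= B by exact: le_trans B1.
have := ler_wpM2l B0 IH; rewrite mulrA -exprS => IH'.
have Bj : 1 <= B ^+ j.+1 by rewrite exprn_ege1.
have : M + E <= B ^+ j.+1 * (M + E) by rewrite ler_peMl// addr_ge0.
rewrite -natr1; nra.
Qed.

End error.

End euler_scheme.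

Section euler_convergence.
Context {R : realType}.
Notation mu := (@lebesgue_measure R).
Variables (phi : R -> R) (phin : nat -> R -> R) (b : R) (beta : nat -> R).
Hypothesis phi_lip : locally_lipschitz phi.
Hypothesis phin_slope : forall n, slopes_between b (beta n) (phin n).
Hypothesis phin_cvg : forall k, 0 <= k -> exists2 e : nat -> R,
  e n @[n --> \oo] --> 0 &
  forall n z, 0 <= z <= k -> `|phi z - phin n z| <= e n.
Hypothesis phin_bernstein : forall n h a, 0 <= h -> 0 < a ->
  h * beta n <= 1 -> bernstein (euler_map (phin n) h a).
Variable t : R.
Hypothesis t_gt0 : 0 < t.

(** Enough steps for [step n * beta n <= 1], which makes the Euler maps
    Bernstein, and more than [n], so that the mesh tends to [0]. *)
Definition nb_steps n : nat := (Num.bound (t * `|beta n|) + n).+1.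
Definition step n : R := t / (nb_steps n)%:R.
Definition euler_approx x lam n : R :=
  euler (phin n) x t (step n) (expR (x t) * lam) (nb_steps n).

Lemma step_gt0 n : 0 < step n.
Proof. by rewrite divr_gt0// ltr0n. Qed.

Lemma step_nb_steps n : step n * (nb_steps n)%:R = t.
Proof. by rewrite /step mulfVK// pnatr_eq0. Qed.

Lemma step_beta n : step n * beta n <= 1.
Proof.
rewrite /step mulrAC ler_pdivrMr ?ltr0n// mul1r.
rewrite (le_trans (ler_wpM2l (ltW t_gt0) (ler_norm _)))//.
have : 0 <= t * `|beta n| by rewrite mulr_ge0// ltW.
move=> /archi_boundP/ltW/le_trans; apply.
by rewrite ler_nat /nb_steps -addnS leq_addr.
Qed.

Lemma step_cvg0 : step n @[n --> \oo] --> 0.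
Proof.
apply: (@squeeze_cvgr _ _ _ _ (fun=> 0) (fun n => t * n.+1%:R^-1)).
- near=> n; rewrite (ltW (step_gt0 n))/= /step ler_pM2l// lef_pV2 ?posrE ?ltr0n//.
  by rewrite ler_nat /nb_steps ltnS leq_addl.
- exact: cvg_cst.
- rewrite -[X in _ --> X](mulr0 t); apply: cvgMl_tmp; exact: cvg_harmonic.
Unshelve. all: end_near. Qed.

Lemma euler_bernstein n x j : bernstein (fun lam =>
  euler (phin n) x t (step n) (expR (x t) * lam) j).
Proof.
elim: j => [|j IH]; first exact/bernstein_linear/expR_ge0.
apply: (bernstein_comp (phin_bernstein _ _ _) IH).
- exact/ltW/step_gt0.
- exact: expR_gt0.
- exact: step_beta.
Qed.

Lemma euler_cvg x lam v : cadlag x -> 0 <= lam ->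
  cumulant_solution phi x t lam v ->
  euler_approx x lam n @[n --> \oo] --> expR (x 0) * v 0.
Proof.
move=> cx lam0 vP; have [k k0 kP] := flow_bounded phi_lip cx t_gt0 lam0 vP.
have [e e0 eP] := phin_cvg k0.
have xk s : 0 <= s <= t -> expR (x s) <= k by move=> /kP[].
have vk s : 0 <= s <= t -> v s <= k by move=> /kP[].
pose g := flow_rate phi x v.
have gk s : 0 <= s <= t -> `|g s| <= k by move=> /kP[].
have ig : mu.-integrable `[0, t] (EFin \o g) by exact: (integrable_flow_rate vP).
have rg : right_continuous_upto t g by exact: (flow_rate_right_continuous phi_lip cx t_gt0 lam0 vP).
have [Di Dcv] := riemann_error_cvg ig rg gk step_gt0 step_cvg0.
set D := fun n s => `|g s - g (grid_right t (step n) s)| in Di Dcv.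
have bound n : `|expR (x 0) * v 0 - euler_approx x lam n| <=
    expR (t * `|b|) * (\int[mu]_(s in `[0, t]) D n s + t * (k * e n)).
  have eu j : (j <= nb_steps n)%N ->
      0 <= euler (phin n) x t (step n) (expR (x t) * lam) j.
    by move=> _; have [H _] := euler_bernstein n x j; exact: H.
  have := euler_error t_gt0 vP (phin_slope n) (step_gt0 n)
    (step_nb_steps n) (step_beta n) xk vk (eP n) eu (Di n) (leqnn _).
  rewrite step_nb_steps subrr distrC => /le_trans; apply.
  rewrite mulrA [(nb_steps n)%:R * _]mulrC step_nb_steps.
  apply: ler_wpM2r.
    rewrite addr_ge0//; first by apply: Rintegral_ge0 => s _; exact: normr_ge0.
    have en0 : 0 <= e n by rewrite (le_trans (normr_ge0 _) (eP n 0 _))// lexx.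
    by rewrite !mulr_ge0// ltW.
  rewrite -[X in expR (X * _)](step_nb_steps n).
  rewrite [X in expR X](_ : _ = (nb_steps n)%:R * (step n * `|b|)); last first.
    by rewrite mulrA [(nb_steps n)%:R * _]mulrC.
  rewrite expRM_natl.
  rewrite lerXn2r ?nnegrE ?expR_ge0// ?expR_ge1Dx//.
  by rewrite addr_ge0// mulr_ge0// ltW// step_gt0.
apply/cvgrPdist_le => eps eps0.
have : expR (t * `|b|) * (\int[mu]_(s in `[0, t]) D n s + t * (k * e n))
    @[n --> \oo] --> 0.
  rewrite -[X in _ --> X](mulr0 (expR (t * `|b|))); apply: cvgMl_tmp.
  rewrite -[X in _ --> X]addr0; apply: cvgD => //.
  rewrite -[X in _ --> X](mulr0 t); apply: cvgMl_tmp.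
  by rewrite -[X in _ --> X](mulr0 k); apply: cvgMl_tmp.
move=> /cvgrPdist_le/(_ _ eps0); apply: filterS => n.
rewrite sub0r normrN => /(le_trans (ler_norm _)); exact/le_trans/bound.
Qed.

Lemma cumulant_cvg x lam v : cadlag x -> 0 <= lam ->
  cumulant_solution phi x t lam v ->
  expR (- x 0) * euler_approx x lam n @[n --> \oo] --> v 0.
Proof.
move=> cx lam0 vP.
have -> : v 0 = expR (- x 0) * (expR (x 0) * v 0).
  by rewrite mulrA -expRD addNr expR0 mul1r.
by apply: cvgMl_tmp; exact: euler_cvg.
Qed.

Lemma cumulant_bernstein x (v : R -> R -> R) : cadlag x ->
  (forall lam, 0 <= lam -> cumulant_solution phi x t lam (v lam)) ->
  bernstein (fun lam => v lam 0).
Proof.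
move=> cx vP.
apply: (@bernstein_cvg _ (fun n lam => expR (- x 0) * euler_approx x lam n)).
  near=> n; apply: (bernstein_comp (bernstein_linear (expR_ge0 _))).
  exact: euler_bernstein.
by move=> lam lam0; apply: cumulant_cvg => //; exact: vP.
Unshelve. all: end_near. Qed.

(** The truncation at [0] extends the restriction to nonnegative arguments to a
    function on the line, which is nondecreasing up to a linear term. *)
Lemma measurable_phin n : measurable_fun setT (fun z : R => phin n (Num.max z 0)).
Proof.
rewrite (_ : (fun z => _) = (fun z : R => phin n (Num.max z 0) - b * Num.max z 0 + b * Num.max z 0)).
  apply: measurable_funD; last first.
    by apply: measurable_funM => //; exact: measurable_maxr.
  apply: nondecreasing_measurable => // y z yz.
  have yz' : Num.max y 0 <= Num.max z 0 by rewrite ge_max le_max yz/= le_max lexx orbT.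
  have y0 : 0 <= Num.max y 0 by rewrite le_max lexx orbT.
  have /andP[+ _] := phin_slope n y0 yz'; lra.
by apply/funext => z; rewrite subrK.
Qed.

(** Each Euler approximation is a measurable function of finitely many values
    of the environment. *)
Lemma measurable_cumulant d (Om : measurableType d) (xi : R -> Om -> R) lam
    (v : Om -> R -> R) : 0 <= lam ->
  (forall s, 0 <= s -> measurable_fun setT (xi s)) ->
  (forall w, cadlag (xi ^~ w)) ->
  (forall w, cumulant_solution phi (xi ^~ w) t lam (v w)) ->
  measurable_fun setT (fun w => v w 0).
Proof.
move=> lam0 mxi cxi vP.
have mexp s : 0 <= s -> measurable_fun setT (fun w => expR (xi s w)).
  by move=> s0; apply: measurableT_comp => //; exact: mxi.
apply: (@measurable_fun_cvg _ _ _ setT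
    (fun n w => expR (- xi 0 w) * euler_approx (xi ^~ w) lam n)); last first.
  by move=> w _; apply: (cumulant_cvg (cxi w)).
move=> n; apply: measurable_funM.
  by apply: measurableT_comp => //; apply: measurableT_comp => //; exact: mxi.
rewrite /euler_approx.
have : (nb_steps n <= nb_steps n)%N by [].
elim: {-2}(nb_steps n) => [_|j IH jN].
  by apply: measurable_funM => //; apply: mexp; exact: ltW.
have {}IH := IH (ltnW jN).
have tj : 0 <= t - step n * j%:R.
  by rewrite subr_ge0 -[leRHS](step_nb_steps n) ler_pM2l ?step_gt0// ler_nat ltnW.
rewrite /= /euler_map; apply: measurable_funB => //.
apply: measurable_funM => //; apply: measurable_funM; first exact: mexp.
under eq_fun => w.
  rewrite -[X in phin n X](@max_l _ _ _ 0); last first.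
    by rewrite divr_ge0 ?expR_ge0//; have [H _] := euler_bernstein n (xi ^~ w) j; exact: H.
  over.
apply: (measurableT_comp (measurable_phin n)).
apply: measurable_funM => //.
under eq_fun do rewrite -expRN.
by apply: measurableT_comp => //; apply: measurableT_comp => //; exact: mxi.
Qed.

End euler_convergence.

(** * Grey's condition bounds the cumulants *)

Section grey_bound.
Context {R : realType}.
Notation mu := (@lebesgue_measure R).
Variable phi : R -> R.

(** Convexity at the origin: it makes [phi z / z] nondecreasing, which is how
    the unknown value of the environment is replaced by its upper bound. *)
Definition star_shaped : Prop :=
  forall a z, 0 <= a <= 1 -> 0 <= z -> phi (a * z) <= a * phi z.

Hypothesis phi_star : star_shaped.

Lemma star_shaped_nondecreasing (theta : R) : 0 < theta ->
  (forall z, theta <= z -> 0 < phi z) ->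
  forall z z', theta <= z -> z <= z' -> phi z <= phi z'.
Proof.
move=> th0 thP z z' thz zz'.
have z0 : 0 < z by exact: lt_le_trans thz.
have z'0 : 0 < z' by exact: lt_le_trans zz'.
have a01 : 0 <= z / z' <= 1.
  by rewrite divr_ge0 ?(ltW z0) ?(ltW z'0)//= ler_pdivrMr// mul1r.
have := phi_star a01 (ltW z'0); rewrite divfK ?gt_eqF// => /le_trans; apply.
have /andP[_ a1] := a01; rewrite ler_piMl//.
by rewrite ltW// thP// (le_trans thz).
Qed.

(** A solution of [u' >= phi u] needs at most this time to go from
    [theta 2 ^ k] to [theta 2 ^ (k + 1)]. *)
Definition dyadic_time theta k : R := theta * 2 ^+ k / phi (theta * 2 ^+ k).

Lemma dyadic_time_gt0 (theta : R) k : 0 < theta ->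
  (forall z, theta <= z -> 0 < phi z) -> 0 < dyadic_time theta k.
Proof.
move=> th0 thP; rewrite divr_gt0 ?mulr_gt0 ?exprn_gt0// thP//.
by rewrite ler_peMr ?(ltW th0)// exprn_ege1// ler1n.
Qed.

(** Half of [dyadic_time theta (k + 1)] is at most the integral of [1 / phi]
    over the dyadic interval that ends at [theta 2 ^ (k + 1)], so these times
    are summable. *)
Lemma grey_dyadic_tail (theta : R) : 0 < theta ->
  (forall z, theta <= z -> 0 < phi z) ->
  (\int[mu]_(z in `[theta, +oo[) ((phi z)^-1)%:E < +oo)%E ->
  forall t : R, 0 < t -> exists k, (0 < k)%N /\
    forall n, \sum_(k <= j < k + n) dyadic_time theta j < t.
Proof.
move=> th0 thP intphi t t0.
(* [1 / phi] is nonincreasing on [[theta, +oo[]; stopping it at [theta] gives a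
   nonincreasing, hence measurable, function on the line. *)
pose psi (z : R) : R := (phi (Num.max z theta))^-1.
have psi0 z : 0 <= psi z by rewrite invr_ge0 ltW// thP// le_max lexx orbT.
have mpsi D : measurable D -> measurable_fun D psi.
  move=> mD; apply: nonincreasing_measurable => // y z yz.
  rewrite /psi lef_pV2 ?posrE ?thP ?le_max ?lexx ?orbT//.
  apply: (star_shaped_nondecreasing th0 thP); first by rewrite le_max lexx orbT.
  by rewrite ge_max !le_max yz lexx orbT.
have intpsi : (\int[mu]_(z in `[theta, +oo[) (psi z)%:E < +oo)%E.
  rewrite [ltLHS](_ : _ = (\int[mu]_(z in `[theta, +oo[) ((phi z)^-1)%:E)%E)//.
  apply: eq_integral => z.
  by rewrite inE/= in_itv/= andbT => thz; rewrite /psi max_l.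
pose a k := dyadic_time theta k.
have a0 k : 0 <= a k by exact/ltW/dyadic_time_gt0.
pose p k : R := theta * 2 ^+ k.
have thp k : theta <= p k by rewrite ler_peMr ?(ltW th0)// exprn_ege1// ler1n.
have p2 k : p k.+1 = 2 * p k by rewrite /p exprS; ring.
have comp n : ((\sum_(0 <= k < n) a k.+1 / 2)%:E +
    \int[mu]_(z in `[p n, +oo[) (psi z)%:E <= \int[mu]_(z in `[theta, +oo[) (psi z)%:E)%E.
  elim: n => [|n]; first by rewrite big_nil add0e /p expr0 mulr1.
  apply: le_trans; rewrite big_nat_recr//= EFinD -addeA leeD2l//.
  have pn0 : 0 < p n by exact: lt_le_trans (thp n).
  have -> : `[p n, +oo[%classic = `[p n, p n.+1[ `|` `[p n.+1, +oo[.
    by rewrite -itv_bndbnd_setU// bnd_simp p2; lra.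
  rewrite ge0_integral_setU//=.
  - apply: leeD2r.
    have -> : (a n.+1 / 2)%:E = (\int[mu]_(z in `[p n, p n.+1[) (psi (p n.+1))%:E)%E.
      rewrite integral_cst//= lebesgue_measure_itv/= lte_fin.
      rewrite ifT; last by rewrite p2; lra.
      rewrite -EFinD -EFinM; congr EFin.
      rewrite /psi max_l// /a /dyadic_time -/(p n.+1) p2.
      have phi_neq0 : phi (2 * p n) != 0 by rewrite -p2 gt_eqF// thP.
      by move: (p n) phi_neq0 => q q0; field.
    apply: ge0_le_integral => //=.
    + by move=> z _; rewrite lee_fin.
    + by apply/measurable_EFinP; exact: mpsi.
    + move=> z; rewrite in_itv/= => /andP[pz zp]; rewrite lee_fin /psi.
      rewrite lef_pV2 ?posrE ?thP ?le_max ?lexx ?orbT//.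
      apply: (star_shaped_nondecreasing th0 thP); first by rewrite le_max lexx orbT.
      by rewrite ge_max !le_max (ltW zp) lexx orbT.
  - by apply/measurable_EFinP; apply: mpsi; exact: measurableU.
  - by move=> z _; rewrite lee_fin.
  - apply/disj_setPS => z /= []; rewrite !in_itv/= andbT => /andP[_ z1].
    by move=> /(lt_le_trans z1); rewrite ltxx.
pose B := fine (\int[mu]_(z in `[theta, +oo[) (psi z)%:E)%E.
have BE : (\int[mu]_(z in `[theta, +oo[) (psi z)%:E = B%:E)%E.
  rewrite fineK// ge0_fin_numE//; apply: integral_ge0 => z _.
  by rewrite lee_fin.
pose S n := \sum_(0 <= k < n) a k.+1.
have SB n : S n <= 2 * B.
  have := comp n; rewrite BE => cn.
  have : ((\sum_(0 <= k < n) a k.+1 / 2)%:E <= B%:E)%E.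
    apply: le_trans cn; rewrite leeDl//; apply: integral_ge0 => z _.
    by rewrite lee_fin.
  by rewrite lee_fin -mulr_suml -/(S n); lra.
have Smono : {homo S : m n / (m <= n)%N >-> m <= n}.
  move=> i j ij; rewrite /S [leRHS](big_cat_nat _ ij)//= lerDl.
  by apply: sumr_ge0 => k _.
have Scv : cvgn S.
  apply: nondecreasing_is_cvgn; first by move=> i j; exact: Smono.
  by exists (2 * B) => _ [n _ <-].
have := Scv; move=> /cvgrPdist_lt/(_ _ t0)[k _ kP].
exists k.+1; split=> // n.
have -> : \sum_(k.+1 <= j < k.+1 + n) dyadic_time theta j = S (k + n)%N - S k.
  rewrite /S [in RHS](big_cat_nat _ (leq_addr n k))//= addrAC subrr add0r.
  by rewrite addSn big_add1.
have := kP k (leqnn k); rewrite ger0_norm; last first.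
  by rewrite subr_ge0; exact: nondecreasing_cvgn_le.
apply: le_lt_trans; rewrite lerD2r.
exact: nondecreasing_cvgn_le.
Qed.

Section growth.
Variables (theta t lip : R) (u f : R -> R).
Hypotheses (theta_gt0 : 0 < theta) (phi_gt0 : forall z, theta <= z -> 0 < phi z).
Hypotheses (t_ge0 : 0 <= t) (fi : mu.-integrable `[0, t] (EFin \o f)).
Hypothesis uE : forall r s, 0 <= r -> r <= s -> s <= t ->
  u s - u r = \int[mu]_(q in `[r, s]) f q.
Hypothesis f_ge : forall s, 0 <= s <= t -> phi (u s) <= f s.
Hypothesis f_lip : forall s, 0 <= s <= t -> `|f s| <= lip.

Let integrable_f r s : 0 <= r -> s <= t -> mu.-integrable `[r, s] (EFin \o f).
Proof.
by move=> r0 st; apply: integrableS fi => //; apply: subset_itvScc; rewrite bnd_simp.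
Qed.

Lemma growth_lower (r s c : R) : 0 <= r -> r <= s -> s <= t ->
  (forall q, r <= q <= s -> c <= f q) -> u r + c * (s - r) <= u s.
Proof.
move=> r0 rs st cf; rewrite addrC -lerBrDr uE//.
have -> : c * (s - r) = \int[mu]_(q in `[r, s]) (fun=> c) q.
  rewrite Rintegral_cst//= lebesgue_measure_itv/= lte_fin.
  move: rs; rewrite le_eqVlt => /predU1P[->|rs]; last by rewrite rs.
  by rewrite subrr ltxx.
apply: le_Rintegral => //.
- apply: (@measurable_bounded_integrable _ _ _ mu (fun=> c)) => //.
  + by rewrite /= lebesgue_measure_itv/=; case: ifP => // _; rewrite ltry.
  + by apply: bounded_cst.
- exact: integrable_f.
Qed.

(** The function [u] cannot fall from [y] to [theta] in less than the time
    [del = (y - theta) / (lip + 1)], and its derivative is positive while it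
    stays above [theta]; hence it stays above [y] during [del], and then
    during any multiple of [del]. *)
Lemma growth_stays_above y r : theta < y -> 0 <= r <= t -> y <= u r ->
  forall s, r <= s <= t -> y <= u s.
Proof.
move=> thy /[dup] r0t /andP[r0 rt] yr.
have lip0 : 0 <= lip := le_trans (normr_ge0 _) (f_lip r0t).
pose del := (y - theta) / (lip + 1).
have l1 : 0 < lip + 1 by rewrite ltr_wpDl.
have del0 : 0 < del by rewrite divr_gt0// subr_gt0.
have H n s : r <= s <= t -> s <= r + del *+ n -> y <= u s.
  elim: n s => [|n IH] s /andP[rs st].
    by rewrite mulr0n addr0 => sr; rewrite (_ : s = r)//; apply/le_anti/andP.
  move=> sn; have [|/ltW ns] := leP s (r + del *+ n).
    by apply: IH; rewrite rs.
  set r' := r + del *+ n in ns *.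
  have rr' : r <= r' by rewrite lerDl mulrn_wge0// ltW.
  have yr' : y <= u r' by apply: IH; rewrite ?rr' ?(le_trans ns st).
  apply: (le_trans yr'); rewrite -[leLHS]addr0 -[X in _ + X](mul0r (s - r')).
  apply: growth_lower => //; first exact: le_trans r0 rr'.
  move=> q /andP[r'q qs].
  have q0t : 0 <= q <= t.
    by rewrite (le_trans r0 (le_trans rr' r'q)) (le_trans qs st).
  apply: (le_trans _ (f_ge q0t)); apply/ltW/phi_gt0.
  have low : u r' + - lip * (q - r') <= u q.
    apply: growth_lower (le_trans r0 rr') r'q (le_trans qs st) _.
    move=> q' /andP[q'1 q'2]; have : `|f q'| <= lip.
      apply: f_lip; rewrite (le_trans r0 (le_trans rr' q'1))/=.
      by rewrite (le_trans q'2)// (le_trans qs).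
    by rewrite ler_norml => /andP[].
  apply: le_trans low.
  have : q - r' <= del.
    by move: sn; rewrite mulrSr addrA -/r' => sn; rewrite lerBlDl (le_trans qs).
  rewrite /del ler_pdivlMr// => qd.
  have : 0 <= q - r' by rewrite subr_ge0.
  nra.
move=> s rst; apply: (H (Num.bound ((s - r) / del))) => //.
have /andP[rs _] := rst.
have : 0 <= (s - r) / del by rewrite divr_ge0 ?subr_ge0 ?(ltW del0).
move=> /archi_boundP; rewrite ltr_pdivrMr// -lerBlDl => /ltW.
by rewrite mulr_natl.
Qed.

Lemma growth_doubling k r : (0 < k)%N -> 0 <= r ->
  r + dyadic_time theta k <= t -> theta * 2 ^+ k <= u r ->
  theta * 2 ^+ k.+1 <= u (r + dyadic_time theta k).
Proof.
move=> k0 r0; set y := theta * 2 ^+ k; set s := r + _ => st yr.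
have thy : theta < y.
  by rewrite ltr_pMr// exprn_egt1// -?lt0n// ltr1n.
have d0 : 0 < dyadic_time theta k by exact: dyadic_time_gt0.
have rs : r <= s by rewrite lerDl ltW.
have rt : 0 <= r <= t by rewrite r0 (le_trans rs).
have H := growth_stays_above thy rt yr.
have low : u r + phi y * (s - r) <= u s.
  apply: growth_lower => // q /andP[rq qs]; have qt := le_trans qs st.
  apply: (le_trans _ (f_ge _)); last by rewrite (le_trans r0).
  apply: (star_shaped_nondecreasing theta_gt0 phi_gt0); first exact: ltW.
  by apply: H; rewrite rq.
apply: le_trans low.
rewrite /s [r + _ - r]addrAC subrr add0r /dyadic_time -/y [phi y * _]mulrC divfK.
  by rewrite exprS mulrCA -/y; lra.
by rewrite gt_eqF// phi_gt0// ltW.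
Qed.

(** Otherwise [u] would double along times whose sum stays below [t], and be
    unbounded on [[0, t]]. *)
Lemma growth_initial_bound k bd : (0 < k)%N ->
  (forall n, \sum_(k <= j < k + n) dyadic_time theta j < t) ->
  (forall s, 0 <= s <= t -> u s <= bd) -> u 0 < theta * 2 ^+ k.
Proof.
move=> k0 tail ub; rewrite ltNge; apply/negP => u0.
have d0 j : 0 <= dyadic_time theta j by exact/ltW/dyadic_time_gt0.
pose S n := \sum_(k <= j < k + n) dyadic_time theta j.
have S0 n : 0 <= S n by apply: sumr_ge0.
have H n : theta * 2 ^+ (k + n) <= u (S n).
  elim: n => [|n IH]; first by rewrite addn0 /S addn0 big_geq.
  have SS : S n.+1 = S n + dyadic_time theta (k + n).
    by rewrite /S addnS big_nat_recr// leq_addr.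
  rewrite addnS SS; apply: growth_doubling => //; first by rewrite addn_gt0 k0.
  by rewrite -SS ltW// tail.
have /ub : 0 <= S 0%N <= t by rewrite S0 ltW// tail.
have bd0 : 0 <= bd / theta.
  rewrite divr_ge0 ?(ltW theta_gt0)//.
  rewrite (le_trans _ (ub 0 _))// ?lexx//.
  by rewrite (le_trans _ u0)// mulr_ge0 ?exprn_ge0// ltW.
move=> _; have := archi_boundP bd0; set n := Num.bound _.
rewrite ltNge => /negP; apply.
have : u (S n) <= bd by apply: ub; rewrite S0 ltW// tail.
move=> /(le_trans (H n)) Hn; rewrite ler_pdivlMr// mulrC (le_trans _ Hn)//.
rewrite ler_pM2l// -natrX ler_nat (leq_trans (ltnW (ltn_expl n (ltnSn 1))))//.
by rewrite leq_exp2l// leq_addl.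
Qed.

End growth.

Hypothesis phi_lip : locally_lipschitz phi.

(** The lemmas on growth apply to [u = flow_mass / kap] where [kap] bounds
    [exp x] on [[0, t]]: since [phi] is star-shaped,
    [exp x * phi (exp (- x) w) >= kap * phi (w / kap)].  The bound does not
    depend on the terminal value [lam]. *)
Lemma cumulant_bounded x t : grey_condition phi -> cadlag x -> 0 < t ->
  exists z, forall lam v, 0 <= lam -> cumulant_solution phi x t lam v ->
    v 0 <= z.
Proof.
move=> [theta [th0 thP gi]] cx t0.
have [k [k0 tail]] := grey_dyadic_tail th0 thP gi t0.
have [kx xk] := cadlag_bounded t cx.
pose kap := expR kx; have kap0 : 0 < kap by exact: expR_gt0.
exists (expR (- x 0) * (kap * (theta * 2 ^+ k))) => lam v lam0 vP.
have [lip lip0 lP] := flow_bounded phi_lip cx t0 lam0 vP.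
have [v0 _ _] := vP.
have ki0 : 0 <= kap^-1 by rewrite invr_ge0 ltW.
pose u s := kap^-1 * flow_mass x v s.
pose f s := kap^-1 * flow_rate phi x v s.
have fir r s : 0 <= r -> s <= t ->
  mu.-integrable `[r, s] (EFin \o (flow_rate phi x v)) by exact: (integrable_flow_rate vP).
have u0 : u 0 < theta * 2 ^+ k.
  apply: (@growth_initial_bound theta t (kap^-1 * lip) u f th0 thP (ltW t0) _ _ _ _ k
    (kap^-1 * (lip * lip)) k0 tail).
  - rewrite (_ : _ \o _ = (fun s => kap^-1%:E * (EFin \o (flow_rate phi x v)) s)%E)//.
    by apply: integrableZl => //; exact: fir.
  - move=> r s r0 rs st; rewrite -mulrBr (flow_massB vP)// RintegralZl//.
    exact: fir.
  - move=> s s0t.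
    have ek : expR (x s) <= kap.
      by rewrite ler_expR (le_trans (ler_norm _))// xk.
    have := @phi_star (expR (x s) / kap) (v s).
    rewrite divr_ge0 ?expR_ge0 ?(ltW kap0)//= ler_pdivrMr// mul1r.
    move=> /(_ ek (v0 _ s0t)).
    by rewrite /u /f /flow_mass /flow_rate !mulrA [_ / kap]mulrC.
  - move=> s s0t; rewrite normrM ger0_norm// ler_wpM2l//.
    by have [] := lP _ s0t.
  - move=> s s0t; rewrite ler_wpM2l// /flow_mass.
    by have [? ? _] := lP _ s0t; rewrite ler_pM ?expR_ge0// v0.
rewrite [leLHS](_ : _ = expR (- x 0) * (kap * u 0)).
  by rewrite ler_wpM2l ?expR_ge0// ler_wpM2l ?(ltW kap0)// ltW.
rewrite /u mulVKf ?gt_eqF// /flow_mass mulrA -expRD addNr expR0 mul1r//.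
Qed.

End grey_bound.

(** * Sums of exponentials approximate measurable functions *)

Section unit_expsums.
Context {R : realType}.
Implicit Types (s : seq (R * R)) (y : R).

Definition unit_expsum s : Prop :=
  nneg_exps s /\ forall y, 0 <= y -> 0 <= expsum s y <= 1.

Definition compl_comb s : seq (R * R) := (1, 0) :: [seq (- p.1, p.2) | p <- s].

Lemma comb_compl s (L : R -> R) : comb (compl_comb s) L = L 0 - comb s L.
Proof.
rewrite /comb big_cons/= mul1r big_map; congr (_ + _).
by rewrite -sumrN; apply: eq_bigr => p _; rewrite mulNr.
Qed.

Lemma nneg_exps_compl s : nneg_exps s -> nneg_exps (compl_comb s).
Proof.
move=> s0 p; rewrite in_cons => /predU1P[->//|/mapP[q qs ->]] /=; exact: s0 qs.
Qed.

Lemma expsum_compl s y : expsum (compl_comb s) y = 1 - expsum s y.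
Proof. by rewrite /expsum comb_compl mul0r oppr0 expR0. Qed.

Lemma unit_expsum_compl s : unit_expsum s -> unit_expsum (compl_comb s).
Proof.
move=> [s0 s1]; split=> [|y y0]; first exact: nneg_exps_compl.
by rewrite expsum_compl; have := s1 _ y0; lra.
Qed.

Definition mul_comb s s' : seq (R * R) :=
  [seq (p.1 * q.1, p.2 + q.2) | p <- s, q <- s'].

Lemma expsum_mul s s' y : expsum (mul_comb s s') y = expsum s y * expsum s' y.
Proof.
rewrite /expsum /comb /mul_comb big_allpairs_dep/= mulr_suml.
apply: eq_bigr => p _; rewrite mulr_sumr; apply: eq_bigr => q _.
by rewrite mulrDl opprD expRD; ring.
Qed.

Lemma unit_expsum_mul s s' : unit_expsum s -> unit_expsum s' ->
  unit_expsum (mul_comb s s').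
Proof.
move=> [s0 s1] [s0' s1']; split=> [p /allpairsP[[q q'] /= [qs qs' ->]]|y y0] /=.
  by apply: addr_ge0; [exact: s0 qs|exact: s0' qs'].
rewrite expsum_mul; have /andP[a b] := s1 _ y0; have /andP[c d] := s1' _ y0.
by rewrite mulr_ge0//= mulr_ile1.
Qed.

Definition scale_comb k s : seq (R * R) := [seq (k * p.1, p.2) | p <- s].

Lemma expsum_scale k s y : expsum (scale_comb k s) y = k * expsum s y.
Proof.
rewrite /expsum /comb /scale_comb big_map mulr_sumr.
by apply: eq_bigr => p _; rewrite mulrA.
Qed.

Lemma expsum_cat s s' y : expsum (s ++ s') y = expsum s y + expsum s' y.
Proof. by rewrite /expsum /comb big_cat. Qed.

Lemma unit_expsum_convex k s s' : 0 <= k <= 1 -> unit_expsum s ->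
  unit_expsum s' -> unit_expsum (scale_comb k s ++ scale_comb (1 - k) s').
Proof.
move=> k01 [s0 s1] [s0' s1']; split=> [p|y y0].
  by rewrite mem_cat => /orP[] /mapP[q qs ->] /=; [exact: s0 qs|exact: s0' qs].
rewrite expsum_cat !expsum_scale.
by have := s1 _ y0; have := s1' _ y0; nra.
Qed.

Lemma unit_expsum_exp l : 0 <= l -> unit_expsum [:: (1, l)].
Proof.
move=> l0; split=> [p|y y0]; first by rewrite mem_seq1 => /eqP ->.
rewrite /expsum /comb big_seq1 mul1r expR_ge0/=.
by have /andP[] := expRN_itv (mulr_ge0 l0 y0).
Qed.

Lemma unit_expsum_nil : unit_expsum ([::] : seq (R * R)).
Proof. by split=> // y _; rewrite /expsum /comb big_nil lexx ler01. Qed.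

Fixpoint exp_comb s n := if n is n'.+1 then mul_comb s (exp_comb s n')
  else compl_comb [::].

Lemma expsum_exp s n y : expsum (exp_comb s n) y = expsum s y ^+ n.
Proof.
elim: n => [|n IH] /=; last by rewrite expsum_mul IH exprS.
by rewrite expsum_compl /expsum /comb big_nil subr0 expr0.
Qed.

Lemma unit_expsum_power s n : unit_expsum s -> unit_expsum (exp_comb s n).
Proof.
move=> us; elim: n => [|n IH] /=; last exact: unit_expsum_mul.
exact/unit_expsum_compl/unit_expsum_nil.
Qed.

Lemma measurable_expsum s : measurable_fun setT (expsum s).
Proof.
rewrite /expsum /comb; elim: s => [|p s IH].
  by under eq_fun do rewrite big_nil; exact: measurable_cst.
under eq_fun do rewrite big_cons; apply: measurable_funD => //.
apply: measurable_funM => //; apply: measurableT_comp => //.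
by apply: measurableT_comp => //; exact: measurable_funM.
Qed.

End unit_expsums.

Section expsum_approximation.
Context {R : realType} d (T : measurableType d) (mu : {measure set T -> \bar R}).
Variables (D : set T) (Y : T -> R).
Hypotheses (mD : measurable D) (muD : (mu D < +oo)%E).
Hypotheses (mY : measurable_fun setT Y) (Y0 : forall u, D u -> 0 <= Y u).
Implicit Types (F G : R -> R) (s : seq (R * R)) (y : R).

Definition expsum_dist F s : R :=
  \int[mu]_(u in D) `|F (Y u) - expsum s (Y u)|.

(** The random variable [Y] stands for the position of the process.  The
    approximating sums keep their values in [[0, 1]]: this is what makes the
    class stable under products, hence under intersections of sets. *)
Definition expsum_approx F : Prop :=
  [/\ measurable_fun setT F, (forall y, 0 <= y -> 0 <= F y <= 1) &
    forall eps, 0 < eps -> exists2 s, unit_expsum s & expsum_dist F s < eps].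

Lemma bounded_integrable (f : T -> R) C : measurable_fun setT f ->
  (forall u, D u -> `|f u| <= C) -> mu.-integrable D (EFin \o f).
Proof.
move=> mf fC; apply: measurable_bounded_integrable => //.
  exact: measurable_funTS.
exists C; split; first by rewrite num_real.
by move=> M CM u Du; exact: le_trans (fC _ Du) (ltW CM).
Qed.

Lemma integrable_dist F s : measurable_fun setT F ->
  (forall y, 0 <= y -> 0 <= F y <= 1) -> unit_expsum s ->
  mu.-integrable D (EFin \o (fun u => `|F (Y u) - expsum s (Y u)|)).
Proof.
move=> mF F01 [_ s1]; apply: (@bounded_integrable _ 1).
  apply: measurableT_comp => //; apply: measurable_funB.
    exact: measurableT_comp.
  by apply: measurableT_comp => //; exact: measurable_expsum.
move=> u /Y0 u0; rewrite normr_id ler_norml.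
by have := F01 _ u0; have := s1 _ u0; lra.
Qed.

Lemma expsum_approx_expsum s : unit_expsum s -> expsum_approx (expsum s).
Proof.
move=> [s0 s1]; split=> [|//|eps eps0]; first exact: measurable_expsum.
exists s => //; rewrite /expsum_dist.
under eq_Rintegral do rewrite subrr normr0.
by rewrite Rintegral_cst// mul0r.
Qed.

Lemma expsum_approx_compl F : expsum_approx F ->
  expsum_approx (fun y => 1 - F y).
Proof.
move=> [mF F01 Fe]; split=> [|y y0|eps eps0].
- exact: measurable_funB.
- by have := F01 _ y0; lra.
have [s us se] := Fe _ eps0; exists (compl_comb s).
  exact: unit_expsum_compl.
rewrite (_ : expsum_dist _ _ = expsum_dist F s)//.
apply: eq_Rintegral => u _; rewrite expsum_compl distrC; congr (`|_|); ring.
Qed.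

Lemma expsum_approxM F G : expsum_approx F -> expsum_approx G ->
  expsum_approx (fun y => F y * G y).
Proof.
move=> [mF F01 Fe] [mG G01 Ge]; split=> [|y y0|eps eps0].
- exact: measurable_funM.
- have /andP[? ?] := F01 _ y0; have /andP[? ?] := G01 _ y0.
  by rewrite mulr_ge0//= mulr_ile1.
have eps20 : 0 < eps / 2 by rewrite divr_gt0.
have [s us se] := Fe _ eps20; have [s' us' se'] := Ge _ eps20.
exists (mul_comb s s'); first exact: unit_expsum_mul.
rewrite (splitr eps); apply: le_lt_trans (ltrD se se').
rewrite /expsum_dist -RintegralD//; [|exact: integrable_dist..].
apply: le_Rintegral => //.
- apply: (@integrable_dist (fun y => F y * G y));
    [exact: measurable_funM| |exact: unit_expsum_mul].
  move=> y y0; have /andP[? ?] := F01 _ y0; have /andP[? ?] := G01 _ y0.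
  by rewrite mulr_ge0//= mulr_ile1.
- rewrite (_ : _ \o _ = (EFin \o (fun u => `|F (Y u) - expsum s (Y u)|%R)) \+
    (EFin \o (fun u => `|G (Y u) - expsum s' (Y u)|%R)))%E//.
  by apply: integrableD => //; exact: integrable_dist.
move=> u /Y0 u0; rewrite expsum_mul.
set a := F _; set b := G _; set a' := expsum _ _; set b' := expsum _ _.
have /andP[b0 b1] : 0 <= b <= 1 by exact: G01.
have /andP[a0 a1] : 0 <= a' <= 1 by exact: us.2.
have -> : a * b - a' * b' = (a - a') * b + a' * (b - b') by ring.
rewrite (le_trans (ler_normD _ _))// !normrM (ger0_norm b0) (ger0_norm a0).
by rewrite lerD// ?ler_piMr ?ler_piMl.
Qed.

Lemma expsum_approx_convex k F G : 0 <= k <= 1 -> expsum_approx F ->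
  expsum_approx G -> expsum_approx (fun y => k * F y + (1 - k) * G y).
Proof.
move=> k01 [mF F01 Fe] [mG G01 Ge].
have H01 y : 0 <= y -> 0 <= k * F y + (1 - k) * G y <= 1.
  by move=> y0; have := F01 _ y0; have := G01 _ y0; nra.
have mH : measurable_fun setT (fun y => k * F y + (1 - k) * G y).
  by apply: measurable_funD; exact: measurable_funM.
split=> [//|//|eps eps0].
have eps20 : 0 < eps / 2 by rewrite divr_gt0.
have [s us se] := Fe _ eps20; have [s' us' se'] := Ge _ eps20.
have us2 := unit_expsum_convex k01 us us'.
exists (scale_comb k s ++ scale_comb (1 - k) s') => //.
rewrite (splitr eps); apply: le_lt_trans (ltrD se se').
rewrite /expsum_dist -RintegralD//; [|exact: integrable_dist..].
apply: le_Rintegral => //.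
- exact: (integrable_dist mH).
- rewrite (_ : _ \o _ = (EFin \o (fun u => `|F (Y u) - expsum s (Y u)|%R)) \+
    (EFin \o (fun u => `|G (Y u) - expsum s' (Y u)|%R)))%E//.
  by apply: integrableD => //; exact: integrable_dist.
move=> u /Y0 u0; rewrite expsum_cat !expsum_scale.
set a := F _; set b := G _; set a' := expsum _ _; set b' := expsum _ _.
have -> : k * a + (1 - k) * b - (k * a' + (1 - k) * b') =
  k * (a - a') + (1 - k) * (b - b') by ring.
have /andP[k0 k1] := k01; have k1' : 0 <= 1 - k by rewrite subr_ge0.
rewrite (le_trans (ler_normD _ _))// !normrM (ger0_norm k0) (ger0_norm k1').
by rewrite lerD// ler_piMl// lerBlDr lerDl.
Qed.

Lemma expsum_approx_cvg (Fn : nat -> R -> R) F :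
  (forall n, expsum_approx (Fn n)) -> measurable_fun setT F ->
  (forall y, 0 <= y -> Fn n y @[n --> \oo] --> F y) -> expsum_approx F.
Proof.
move=> Fna mF FnF.
have F01 y : 0 <= y -> 0 <= F y <= 1.
  move=> y0; apply/andP; split.
    apply: (cvgr_to_ge (FnF _ y0)); near=> n.
    by have [_ /(_ _ y0)/andP[]] := Fna n.
  apply: (cvgr_to_le (FnF _ y0)); near=> n.
  by have [_ /(_ _ y0)/andP[]] := Fna n.
have mdiff n : measurable_fun setT (fun u => `|F (Y u) - Fn n (Y u)|).
  have [mFn _ _] := Fna n.
  apply: measurableT_comp => //; apply: measurable_funB; exact: measurableT_comp.
have bdiff n u : D u -> `|F (Y u) - Fn n (Y u)| <= 1.
  move=> /Y0 u0; have [_ /(_ _ u0) + _] := Fna n.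
  by have := F01 _ u0; rewrite ler_norml; lra.
have i1 : mu.-integrable D (EFin \o (fun=> 1 : R)).
  by apply: (@bounded_integrable _ 1) => // u _; rewrite normr1.
have cv0 : \int[mu]_(u in D) `|F (Y u) - Fn n (Y u)| @[n --> \oo] --> 0.
  have [] := @dominated_convergence _ _ _ mu D mD
    (fun n u => `|F (Y u) - Fn n (Y u)|%:E) (fun=> 0%E) (EFin \o (fun=> 1)) _ _ _ i1.
  - by move=> n; apply/measurable_EFinP; apply: measurable_funTS; exact: mdiff.
  - exact: measurable_cst.
  - apply/aeW => u /Y0 u0; apply: cvg_EFin; first by near=> n.
    rewrite [X in _ --> X](_ : 0 = `|F (Y u) - F (Y u)|); last by rewrite subrr normr0.
    by apply: cvg_norm; apply: cvgB; [exact: cvg_cst|exact: FnF].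
  - by apply/aeW => u n Du; rewrite /= lee_fin normr_id bdiff.
  by move=> _ _; rewrite integral0 => /fine_cvgP[_].
split=> // eps eps0.
have eps20 : 0 < eps / 2 by rewrite divr_gt0.
have := cv0; move=> /cvgrPdist_lt/(_ _ eps20)[n _ nP].
have [mFn Fn01 /(_ _ eps20)[s us se]] := Fna n.
exists s => //; have := nP n (leqnn n).
rewrite sub0r normrN ger0_norm; last by apply: Rintegral_ge0 => u _; exact: normr_ge0.
move=> en; rewrite (splitr eps); apply: le_lt_trans (ltrD en se).
have id := @bounded_integrable _ 1 (mdiff n).
rewrite /expsum_dist -RintegralD//; last 2 first.
- by apply: id => u Du; rewrite normr_id bdiff.
- exact: integrable_dist.
apply: le_Rintegral => //.
- exact: integrable_dist.
- rewrite (_ : _ \o _ = (EFin \o (fun u => `|F (Y u) - Fn n (Y u)|%R)) \+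
    (EFin \o (fun u => `|Fn n (Y u) - expsum s (Y u)|%R)))%E//.
  apply: integrableD => //; last exact: integrable_dist.
  by apply: id => u Du; rewrite normr_id bdiff.
by move=> u _; exact: ler_distD.
Unshelve. all: end_near. Qed.

(** For [a >= 0] the indicator is the limit of [(1 - exp (- j y)) ^ N j] with
    [N j] of order [j exp (j a)]: the power is at most
    [exp (- j exp (j (a - y)))] and, by Bernoulli's inequality, at least
    [1 - 2 j exp (- j (y - a))]. *)
Lemma expsum_approx_half_line a :
  expsum_approx (\1_(`]a, +oo[%classic : set R) : R -> R).
Proof.
have mI : measurable_fun setT (\1_(`]a, +oo[%classic : set R) : R -> R).
  by apply: measurable_indic; exact: measurable_itv.
have [a0|a0] := ltP a 0.
  apply: (@expsum_approx_cvg (fun=> expsum (compl_comb [::]))) => //.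
    by move=> _; apply/expsum_approx_expsum/unit_expsum_compl/unit_expsum_nil.
  move=> y y0; rewrite indicE mem_set; last by rewrite /= in_itv/= (lt_le_trans a0).
  by rewrite expsum_compl /expsum /comb big_nil subr0; exact: cvg_cst.
(* The extra factor [j.+1] makes the limit at [y = a] equal to [0]. *)
pose N j := (j.+1 * (Num.truncn (expR (j.+1%:R * a))).+1)%N.
pose p j y : R := expR (- (j.+1%:R * y)).
apply: (@expsum_approx_cvg
  (fun j => expsum (exp_comb (compl_comb [:: (1, j.+1%:R)]) (N j)))) => //.
  move=> j; apply/expsum_approx_expsum/unit_expsum_power/unit_expsum_compl.
  exact: unit_expsum_exp.
move=> y y0.
have E j : expsum (exp_comb (compl_comb [:: (1, j.+1%:R)]) (N j)) y =
    (1 - p j y) ^+ N j.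
  by rewrite expsum_exp expsum_compl /expsum /comb big_seq1 mul1r.
under eq_fun do rewrite E.
have p01 j : 0 <= p j y <= 1 by apply: expRN_itv; rewrite mulr_ge0.
have q01 j : 0 <= 1 - p j y <= 1 by have := p01 j; lra.
have NE j : j.+1%:R * expR (j.+1%:R * a) <= (N j)%:R :> R /\
    (N j)%:R <= 2 * (j.+1%:R * expR (j.+1%:R * a)) :> R.
  rewrite /N natrM.
  have e0 : 0 <= expR (j.+1%:R * a) by exact: expR_ge0.
  have /andP[t1 t2] := truncn_itv e0.
  have e1 : 1 <= expR (j.+1%:R * a) by rewrite -expR0 ler_expR mulr_ge0.
  have j0 : 0 <= j.+1%:R :> R by [].
  rewrite -[(Num.truncn _).+1%:R]natr1 in t2 *.
  by split; nra.
have [ay|ya] := ltP a y; last first.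
  rewrite indicE memNset/=; last by rewrite in_itv/= andbT ltNge ya.
  apply: (@squeeze_cvgr _ _ _ _ (fun=> 0) (fun j => j.+1%:R^-1)); last 2 first.
    exact: cvg_cst.
    exact: cvg_harmonic.
  near=> j; have /andP[q0 q1] := q01 j; rewrite exprn_ge0//=.
  have : 1 - p j y <= expR (- p j y) by exact: expR_ge1Dx.
  move=> /(lerXn2r (N j) q0 (expR_ge0 _))/le_trans; apply.
  rewrite -expRM_natl mulrN expRN lef_pV2 ?posrE ?expR_gt0 ?ltr0n//.
  apply: (le_trans _ (le_trans (_ : _ <= 1 + (N j)%:R * p j y) (expR_ge1Dx _))) => //.
  rewrite -[leLHS]add0r lerD//; have [H _] := NE j.
  have /andP[p0 _] := p01 j.
  apply: (le_trans _ (ler_wpM2r p0 H)).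
  rewrite -mulrA /p -expRD ler_peMr// -expR0 ler_expR.
  by rewrite -mulrBr mulr_ge0// subr_ge0.
rewrite indicE mem_set/=; last by rewrite in_itv/= andbT.
pose c := y - a; have c0 : 0 < c by rewrite subr_gt0.
apply: (@squeeze_cvgr _ _ _ _ (fun j => 1 - 8 / c ^+ 2 * j.+1%:R^-1) (fun=> 1)); last 2 first.
  rewrite -[X in _ --> X]subr0; apply: cvgB; first exact: cvg_cst.
  rewrite -[X in _ --> X](mulr0 (8 / c ^+ 2)).
  by apply: cvgMl_tmp; exact: cvg_harmonic.
  exact: cvg_cst.
near=> j; have /andP[q0 q1] := q01 j; rewrite exprn_ile1// andbT.
have bern n : 1 - n%:R * p j y <= (1 - p j y) ^+ n.
  elim: n => [|n IH]; first by rewrite mul0r subr0 expr0.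
  have := ler_wpM2l q0 IH; rewrite -exprS => /(le_trans _); apply.
  have /andP[p0 _] := p01 j.
  have : 0 <= n%:R * (p j y * p j y) by rewrite !mulr_ge0.
  by rewrite -natr1; nra.
apply: le_trans (bern (N j)); rewrite lerD2l lerN2.
have [_ H] := NE j; have /andP[p0 _] := p01 j.
apply: (le_trans (ler_wpM2r p0 H)).
have -> : 2 * (j.+1%:R * expR (j.+1%:R * a)) * p j y =
    2 * (j.+1%:R * expR (- (j.+1%:R * c))).
  by rewrite -!mulrA /p -expRD; congr (_ * (_ * expR _)); rewrite /c; ring.
have J0 : 0 < j.+1%:R :> R by rewrite ltr0n.
set J := j.+1%:R in J0 *; clearbody J.
have Jc : 0 < J * c by rewrite mulr_gt0.
have sq : (J * c) ^+ 2 / 4 <= expR (J * c).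
  rewrite [in leRHS](splitr (J * c)) expRD -expr2.
  have h := expR_ge1Dx (J * c / 2).
  rewrite [leLHS](_ : _ = (J * c / 2) ^+ 2); last by field.
  by rewrite lerXn2r ?nnegrE ?expR_ge0 ?divr_ge0 ?(ltW Jc)//; lra.
have inv : expR (- (J * c)) <= ((J * c) ^+ 2 / 4)^-1.
  by rewrite expRN lef_pV2 ?posrE ?expR_gt0// divr_gt0// exprn_gt0.
have J2 : 0 <= 2 * J by rewrite mulr_ge0// ltW.
rewrite mulrA; apply: (le_trans (ler_wpM2l J2 inv)).
rewrite [leLHS](_ : _ = 8 / c ^+ 2 * J^-1)//.
by field; rewrite !gt_eqF.
Unshelve. all: end_near. Qed.

Lemma expsum_approx_bigcap (A : nat -> set R) :
  (forall n, measurable (A n)) ->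
  (forall n, expsum_approx (\1_(A n) : R -> R)) ->
  expsum_approx (\1_(\bigcap_n A n) : R -> R).
Proof.
move=> mA HA.
have H n : expsum_approx (\1_(\bigcap_(i < n) A i) : R -> R).
  elim: n => [|n IH].
    rewrite (_ : \1_(_) = expsum (compl_comb [::])).
      by apply/expsum_approx_expsum/unit_expsum_compl/unit_expsum_nil.
    apply/funext => y; rewrite expsum_compl /expsum /comb big_nil subr0.
    by rewrite indicE mem_set.
  rewrite bigcap_mkord big_ord_recr/= -bigcap_mkord indicI.
  exact: expsum_approxM.
apply: (expsum_approx_cvg H).
  by apply: measurable_indic; exact: bigcapT_measurable.
move=> y _; apply: cvg_near_cst.
have [yA|] := pselect ((\bigcap_n A n) y).
  near=> n; rewrite !indicE (mem_set yA) mem_set// => i _; exact: yA.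
move=> /[dup] nyA /existsNP[k /not_implyP[_ nAk]].
near=> n; rewrite !indicE (memNset nyA) memNset// => /(_ k) H'; apply: nAk.
by apply: H' => /=; near: n; exact: nbhs_infty_gt.
Unshelve. all: end_near. Qed.

(** The sets whose indicator is approximable form a sigma-algebra that contains
    the half-lines. *)
Lemma expsum_approx_indic (A : set R) : measurable A ->
  expsum_approx (\1_A : R -> R).
Proof.
move=> mA0.
have mA : (@RGenOInfty.G R).-sigma.-measurable A by rewrite -RGenOInfty.measurableE.
suff : <<s @RGenOInfty.G R >> `<=`
    [set A : set R | measurable A /\ expsum_approx (\1_A : R -> R)].
  by move=> /(_ _ mA)[].
have HC (B : set R) : measurable B /\ expsum_approx (\1_B : R -> R) ->
    measurable (~` B) /\ expsum_approx (\1_(~` B) : R -> R).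
  move=> [mB HB]; split; first exact: measurableC.
  rewrite (_ : \1_(~` B) = fun y => 1 - \1_B y); first exact: expsum_approx_compl.
  apply/funext => y; rewrite !indicE in_setC.
  by case: (_ \in _); rewrite /= ?subr0 ?subrr.
apply: smallest_sub => [|_ [x ->]]; last first.
  by split; [exact: measurable_itv|exact: expsum_approx_half_line].
split.
- split => //; rewrite indic0.
  rewrite (_ : cst 0 = expsum [::]).
    exact/expsum_approx_expsum/unit_expsum_nil.
  by apply/funext => y; rewrite /expsum /comb big_nil.
- by move=> B; rewrite setTD; exact: HC.
- move=> B HB; rewrite -[\bigcup_k _]setCK; apply: (HC); split.
    by apply: measurableC; apply: bigcup_measurable => k _; have [] := HB k.
  rewrite setC_bigcup; apply: expsum_approx_bigcap => k.
    by apply: measurableC; have [] := HB k.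
  by have [_] := HC _ (HB k).
Qed.

(** The function is the uniform limit of the averages of the indicators of its
    [n] superlevel sets at the multiples of [1 / n], and averages are iterated
    convex combinations. *)
Lemma expsum_approx_measurable F : measurable_fun setT F ->
  (forall y, 0 <= y -> 0 <= F y <= 1) -> expsum_approx F.
Proof.
move=> mF F01.
pose level n k : set R := F @^-1` `[k.+1%:R / n.+1%:R, +oo[.
have mlevel n k : measurable (level n k).
  by rewrite -[level n k]setTI; apply: mF => //; exact: measurable_itv.
pose avg n k y : R := (\sum_(i < k.+1) \1_(level n i) y) / k.+1%:R.
have avgH n k : expsum_approx (avg n k).
  elim: k => [|k IH].
    rewrite (_ : avg n 0%N = \1_(level n 0%N)); first exact: expsum_approx_indic.
    by apply/funext => y; rewrite /avg big_ord1 divr1.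
  have k01 : 0 <= (k.+2%:R^-1 : R) <= 1 by rewrite invr_ge0 ler0n invf_le1 ?ltr0n// ler1n.
  have := expsum_approx_convex k01 (expsum_approx_indic (mlevel n k.+1)) IH.
  congr expsum_approx; apply/funext => y.
  rewrite /avg [in RHS]big_ord_recr/=.
  have k1 : k.+1%:R != 0 :> R by rewrite pnatr_eq0.
  have k2 : k.+2%:R != 0 :> R by rewrite pnatr_eq0.
  have : k.+2%:R = k.+1%:R + 1 :> R by rewrite natr1.
  move: k1 k2; set K := k.+1%:R; set K2 := k.+2%:R; clearbody K K2.
  by move=> k1 k2 KE; rewrite KE in k2 *; field; rewrite k1 k2.
have count y (x : R) n : 0 <= x ->
  (fun z => \sum_(i < n) (if i.+1%:R <= x then 1 else 0 : R)) y <= x /\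
  Num.min x n%:R - 1 <= (fun z => \sum_(i < n) (if i.+1%:R <= x then 1 else 0 : R)) y.
  move=> x0.
  suff : (n%:R <= x -> \sum_(i < n) (if i.+1%:R <= x then 1 else 0 : R) = n%:R)
     /\ (x < n%:R -> x - 1 <= \sum_(i < n) (if i.+1%:R <= x then 1 else 0 : R) <= x).
    move=> [H1 H2] /=; have [nx|xn] := leP n%:R x.
      by rewrite H1//; split => //; lra.
    by have /andP[] := H2 xn.
  elim: n => [|n [IH1 IH2]]; first by rewrite big_ord0; split => //; lra.
  rewrite big_ord_recr/=; split => [nx|xn].
    by rewrite nx IH1 -?natr1//; apply: le_trans nx; rewrite ler_nat.
  rewrite [n.+1%:R <= x]leNgt xn/= addr0.
  have [nx|] := leP n%:R x; last exact: IH2.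
  by rewrite IH1// nx/= lerBlDr natr1 ltW.
apply: (@expsum_approx_cvg (fun n => avg n n)) => // y y0.
have /andP[F0 F1] := F01 _ y0.
apply: (@squeeze_cvgr _ _ _ _ (fun n => F y - n.+1%:R^-1) (fun=> F y)); last 2 first.
  rewrite -[X in _ --> X]subr0; apply: cvgB; first exact: cvg_cst.
  exact: cvg_harmonic.
  exact: cvg_cst.
near=> n.
have n0 : 0 < n.+1%:R :> R by rewrite ltr0n.
have [c1 c2] := count 0 (n.+1%:R * F y) n.+1 (mulr_ge0 (ltW n0) F0).
have -> : avg n n y = (\sum_(i < n.+1)
    (if i.+1%:R <= n.+1%:R * F y then 1 else 0)) / n.+1%:R.
  rewrite /avg; congr (_ / _); apply: eq_bigr => i _.
  rewrite indicE; case: ifPn => h.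
    by rewrite mem_set// /level/= in_itv/= andbT ler_pdivrMr// mulrC.
  by rewrite memNset// /level/= in_itv/= andbT ler_pdivrMr// mulrC; exact/negP.
rewrite ler_pdivlMr// ler_pdivrMr// mulrBl mulVf ?gt_eqF// [F y * _]mulrC.
rewrite c1 andbT; move: c2; rewrite min_l//.
by rewrite ler_piMr// ltW.
Unshelve. all: end_near. Qed.

End expsum_approximation.

(** * Comparison of two starting points *)

Section infinitely_divisible_comparison.
Context {R : realType}.
Implicit Types (s : seq (R * R)) (L g : R -> R).

Lemma continuous_expsum s : continuous (expsum s).
Proof.
rewrite /expsum /comb; elim: s => [|p s IH] y; rewrite /continuous_at.
  by under eq_fun do rewrite big_nil; rewrite big_nil; exact: cvg_cst.
under eq_fun do rewrite big_cons; rewrite big_cons.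
apply: cvgD; last exact: IH.
apply: cvgMl_tmp; apply: continuous_cvg; first exact: continuous_expR.
by apply: cvgN; apply: cvgMl_tmp; exact: cvg_id.
Qed.

(** The limit [p] is the mass at [y = 0], and what remains is a positive
    measure.  For a nonnegative sum [F], the sum
    [F y + eps - F 0 * exp (- n y)] is nonnegative for large [n]: near [0] by
    continuity of [F], elsewhere because the exponential is small.  Apply [L]
    and let [n] tend to infinity, then [eps] to [0]. *)
Lemma laplace_type_sub_lim L p : laplace_type L ->
  L n%:R @[n --> \oo] --> p -> laplace_type (fun l => L l - p).
Proof.
move=> HL Lp s s0 s1; pose c0 := expsum s 0.
have c00 : 0 <= c0 by exact: s1.
have -> : comb s (fun l => L l - p) = comb s L - c0 * p.
  rewrite /comb /c0 /expsum /comb mulr_suml -sumrB; apply: eq_bigr => q _.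
  by rewrite mulr0 oppr0 expR0; ring.
have L0 : 0 <= L 0.
  have := HL [:: (1, 0)]; rewrite /comb big_seq1 mul1r; apply.
    by move=> q; rewrite mem_seq1 => /eqP ->.
  by move=> y y0; rewrite /expsum /comb big_seq1 mul1r expR_ge0.
have H eps : 0 < eps -> 0 <= eps * L 0 + (- c0 * p + comb s L).
  move=> eps0.
  have /cvgrPdist_lt/(_ _ eps0)[del /= del0 dP] := @continuous_expsum s 0.
  have : eps * L 0 + (- c0 * L n%:R + comb s L) @[n --> \oo] -->
      eps * L 0 + (- c0 * p + comb s L).
    apply: cvgD; first exact: cvg_cst.
    by apply: cvgD; [exact: cvgMl_tmp|exact: cvg_cst].
  move=> /cvgr_to_ge; apply; exists (Num.bound (c0 / (eps * del))) => // n /= Nn.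
  have ed0 : 0 < eps * del by rewrite mulr_gt0.
  have nP : c0 <= n%:R * (eps * del).
    rewrite -ler_pdivrMr//; apply: le_trans (ltW (archi_boundP _)) _.
      by rewrite divr_ge0// ltW.
    by rewrite ler_nat.
  have := HL [:: (eps, 0), (- c0, n%:R) & s]; rewrite !comb_cons/=; apply.
    move=> q; rewrite !in_cons => /predU1P[->//|/predU1P[->//=|qs]]; exact: s0.
  move=> y y0; rewrite /expsum !comb_cons/= -/(expsum s y).
  rewrite mul0r oppr0 expR0 mulr1.
  have /andP[e0 e1] : 0 <= expR (- (n%:R * y)) <= 1 by apply: expRN_itv; rewrite mulr_ge0.
  have Fy := s1 _ y0.
  have [yd|dy] := ltP y del.
    have := dP y; rewrite /= sub0r normrN ger0_norm// => /(_ yd).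
    by rewrite -/c0 ltr_norml => /andP[_ d2]; nra.
  suff : c0 * expR (- (n%:R * y)) <= eps by lra.
  have nd : 1 + n%:R * del <= expR (n%:R * y).
    apply: le_trans (expR_ge1Dx _); rewrite lerD2l ler_wpM2l//.
  have e0' : 0 < expR (n%:R * y) by exact: expR_gt0.
  rewrite expRN ler_pdivrMr//.
  apply: (le_trans _ (ler_wpM2l (ltW eps0) nd)); lra.
have [//|neg] := leP 0 (comb s L - c0 * p).
have L1 : 0 < L 0 + 1 by rewrite ltr_wpDl.
have := H (- (comb s L - c0 * p) / (L 0 + 1)).
rewrite divr_gt0// ?oppr_gt0// => /(_ isT).
have : - (comb s L - c0 * p) / (L 0 + 1) * L 0 < - (comb s L - c0 * p).
  rewrite mulrAC ltr_pdivrMr// ltr_pM2l ?oppr_gt0//; lra.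
lra.
Qed.

Lemma bernstein_nondecreasing g : bernstein g ->
  forall l l', 0 <= l -> l <= l' -> g l <= g l'.
Proof.
move=> [_ gL] l l' l0 ll'.
have := gL 1 ler01 [:: (1, l); (- 1, l')].
rewrite /comb !big_cons !big_nil/= !addr0 !mul1r mulN1r subr_ge0 ler_expR lerN2.
apply.
  by move=> q; rewrite !inE => /orP[] /eqP ->//=; exact: le_trans ll'.
move=> y y0; rewrite /expsum /comb !big_cons !big_nil/= !addr0 !mul1r mulN1r.
by rewrite subr_ge0 ler_expR lerN2 ler_wpM2r.
Qed.

(** Conditionally on the environment, the law from [x + h] dominates
    [exp (- h vb)] times the law from [x], since the mass added by [h] is
    extinct with that probability; this bounds the difference from below.
    The same bound for the complement [1 - s] is the bound from above. *)
Lemma bernstein_comb_diff g s x h vb : bernstein g -> unit_expsum s ->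
  g n%:R @[n --> \oo] --> vb -> 0 <= x -> 0 <= h ->
  `|comb s (fun l => expR (- ((x + h) * g l)))
    - comb s (fun l => expR (- (x * g l)))| <= 1 - expR (- (h * vb)).
Proof.
move=> gB us gvb x0 h0; have [g0 gL] := gB.
have vb0 : 0 <= vb.
  by apply: (cvgr_to_ge gvb); near=> n; exact: g0.
have hL : laplace_type (fun l => expR (- (h * g l)) - expR (- (h * vb))).
  apply: laplace_type_sub_lim; first exact: gL.
  apply: continuous_cvg; first exact: continuous_expR.
  by apply: cvgN; exact: cvgMl_tmp.
have key s' : unit_expsum s' ->
    - (1 - expR (- (h * vb))) <= comb s' (fun l => expR (- ((x + h) * g l)))
      - comb s' (fun l => expR (- (x * g l))).
  move=> us'.
  have s'0 y : 0 <= y -> 0 <= expsum s' y by move=> /us'.2/andP[].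
  have := laplace_typeM (gL _ x0) hL us'.1 s'0.
  set A := comb s' _; have -> : A = comb s' (fun l => expR (- ((x + h) * g l)))
      - expR (- (h * vb)) * comb s' (fun l => expR (- (x * g l))).
    rewrite -combZ /A /comb -sumrB; apply: eq_bigr => p _.
    rewrite -mulrBr; congr (_ * _).
    by rewrite mulrDl opprD expRD; ring.
  have : comb s' (fun l => expR (- (x * g l))) <= 1.
    have uc := unit_expsum_compl us'.
    have c0 y : 0 <= y -> 0 <= expsum (compl_comb s') y by move=> /uc.2/andP[].
    have := gL _ x0 _ uc.1 c0; rewrite comb_compl subr_ge0 => /le_trans; apply.
    by have /andP[] := expRN_itv (mulr_ge0 x0 (g0 0 (lexx 0))).
  have : 0 <= comb s' (fun l => expR (- (x * g l))) by exact: gL us'.1 s'0.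
  have /andP[] := expRN_itv (mulr_ge0 h0 vb0).
  nra.
rewrite ler_norml key//=.
have := key _ (unit_expsum_compl us); rewrite !comb_compl.
have : expR (- ((x + h) * g 0)) <= expR (- (x * g 0)).
  by rewrite ler_expR lerN2 ler_wpM2r ?g0// lerDl.
lra.
Unshelve. all: end_near. Qed.

End infinitely_divisible_comparison.

Section total_variation.
Context {R : realType} d (T : measurableType d).
Variables (m1 m2 : {measure set T -> \bar R}) (D : set T) (Y : T -> R).
Hypotheses (mD : measurable D) (m1D : m1 D = 1%E) (m2D : m2 D = 1%E).
Hypotheses (mY : measurable_fun setT Y) (Y0 : forall u, D u -> 0 <= Y u).
Variable delta : R.
Hypothesis expsum_delta : forall s, unit_expsum s ->
  `|\int[m1]_(u in D) expsum s (Y u) - \int[m2]_(u in D) expsum s (Y u)| <= delta.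

(** A sum of exponentials that is close to [F] in mean for [m1 + m2] is close
    to it for both measures. *)
Lemma unit_function_delta (F : R -> R) : measurable_fun setT F ->
  (forall y, 0 <= y -> 0 <= F y <= 1) ->
  `|\int[m1]_(u in D) F (Y u) - \int[m2]_(u in D) F (Y u)| <= delta.
Proof.
move=> mF F01.
pose mu : {measure set T -> \bar R} := measure_add m1 m2.
have muD : (mu D < +oo)%E.
  have -> : mu D = (m1 D + m2 D)%E by exact: measure_addE.
  by rewrite m1D m2D -EFinD ltry.
have m1f : (m1 D < +oo)%E by rewrite m1D ltry.
have m2f : (m2 D < +oo)%E by rewrite m2D ltry.
have [_ _ Fe] := expsum_approx_measurable mD muD mY Y0 mF F01.
apply/ler_addgt0Pr => eps eps0.
have [s us se] := Fe _ eps0.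
pose f u := F (Y u); pose g u := expsum s (Y u).
have mf : measurable_fun setT f by exact: measurableT_comp.
have mg : measurable_fun setT g.
  by apply: measurableT_comp => //; exact: measurable_expsum.
have f1 u : D u -> `|f u| <= 1.
  by move=> /Y0/F01/andP[f0 ?]; rewrite ger0_norm.
have g1 u : D u -> `|g u| <= 1.
  by move=> /Y0/us.2/andP[f0 ?]; rewrite ger0_norm.
have if1 := bounded_integrable mD m1f mf f1.
have if2 := bounded_integrable mD m2f mf f1.
have ig1 := bounded_integrable mD m1f mg g1.
have ig2 := bounded_integrable mD m2f mg g1.
have mfg : measurable_fun setT (fun u => f u - g u) by exact: measurable_funB.
have fg1 u : D u -> `|f u - g u| <= 2.
  by move=> Du; rewrite (le_trans (ler_normB _ _))// (_ : 2 = 1 + 1 :> R)// lerD ?f1 ?g1.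
have i1 := bounded_integrable mD m1f mfg fg1.
have i2 := bounded_integrable mD m2f mfg fg1.
have e12 : \int[m1]_(u in D) `|f u - g u| + \int[m2]_(u in D) `|f u - g u| < eps.
  have n1 := integrable_norm i1; have n2 := integrable_norm i2.
  apply: le_lt_trans se; rewrite /expsum_dist /Rintegral.
  rewrite -(fineD (integrable_fin_num mD n1) (integrable_fin_num mD n2)).
  by rewrite -(integral_measure_add mD n1 n2).
have d1 := le_normr_Rintegral mD i1; have d2 := le_normr_Rintegral mD i2.
have gd := expsum_delta us.
rewrite !RintegralB// in d1 d2.
rewrite -/(f _) -/(g _) in gd *.
have -> : \int[m1]_(u in D) f u - \int[m2]_(u in D) f u =
  (\int[m1]_(u in D) f u - \int[m1]_(u in D) g u)
  - (\int[m2]_(u in D) f u - \int[m2]_(u in D) g u)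
  + (\int[m1]_(u in D) g u - \int[m2]_(u in D) g u) by ring.
rewrite (le_trans (ler_normD _ _))// [leRHS]addrC lerD//.
rewrite (le_trans (ler_normB _ _))// (le_trans (lerD d1 d2))//.
exact: ltW.
Qed.

(** Reduction to values in [[0, 1]] by an affine change of [F]; the constant
    [M + 1] keeps the divisor positive when [M = 0]. *)
Lemma bounded_function_delta (F : R -> R) M :
  measurable_fun (`[0, +oo[ : set R) F ->
  (forall y, 0 <= y -> `|F y| <= M) ->
  `|\int[m1]_(u in D) F (Y u) - \int[m2]_(u in D) F (Y u)| <= 2 * (M + 1) * delta.
Proof.
move=> mF FM.
have M0 : 0 <= M by rewrite (le_trans _ (FM 0 _)).
have M10 : 0 < 2 * (M + 1) by lra.
pose G y := (F (Num.max y 0) + (M + 1)) / (2 * (M + 1)).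
have mG : measurable_fun setT G.
  apply: measurable_funM => //; apply: measurable_funD => //.
  apply: (@measurable_comp _ _ _ _ _ _ (`[0, +oo[ : set R)) => //.
  - by move=> _ [y _ <-]; rewrite /= in_itv/= andbT le_max lexx orbT.
  - exact: measurable_maxr.
have G01 y : 0 <= y -> 0 <= G y <= 1.
  move=> y0; rewrite /G max_l//; have := FM _ y0; rewrite ler_norml => /andP[a b].
  by rewrite divr_ge0 ?(ltW M10)//= ?ler_pdivrMr ?mul1r//; lra.
have := unit_function_delta mG G01.
have mGY : measurable_fun setT (fun u => G (Y u)) by exact: measurableT_comp.
have G1 u : D u -> `|G (Y u)| <= 1.
  by move=> /Y0/G01/andP[? ?]; rewrite ger0_norm.
have E (mu : {measure set T -> \bar R}) : mu D = 1%E ->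
    \int[mu]_(u in D) F (Y u) =
    2 * (M + 1) * \int[mu]_(u in D) G (Y u) - (M + 1).
  move=> muD.
  have muf : (mu D < +oo)%E by rewrite muD ltry.
  have iG := bounded_integrable mD muf mGY G1.
  have iM : mu.-integrable D (EFin \o (fun=> M + 1)).
    exact: (@bounded_integrable _ _ _ _ _ mD muf _ `|M + 1|).
  rewrite -RintegralZl//.
  transitivity (\int[mu]_(u in D) (2 * (M + 1) * G (Y u) - (M + 1))).
    apply: eq_Rintegral => u; rewrite inE => /Y0 u0; rewrite /G max_l//.
    by field; rewrite gt_eqF//; lra.
  rewrite RintegralB//; first by rewrite Rintegral_cst// muD mulr1.
  rewrite (_ : _ \o _ = (fun u => (2 * (M + 1))%:E *
    (EFin \o (fun u => G (Y u))) u)%E)//.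
  exact: integrableZl.
rewrite !E//.
move=> /(ler_wpM2l (ltW M10)); apply: le_trans.
rewrite -[X in X * `|_|](ger0_norm (ltW M10)) -normrM.
by rewrite le_eqVlt; apply/orP; left; apply/eqP; congr (`|_|); ring.
Qed.

End total_variation.

(** * The strong Feller property *)

Section branching_mechanism_properties.
Context {R : realType} (b c : R) (m : {measure set (measurableTypeR R) -> \bar R}).
Hypotheses (c_ge0 : 0 <= c) (m_branching : branching_measure m).
Let phi := branching_mechanism b c m.
Let midfun : measurable_fun setT (idfun : measurableTypeR R -> R).
Proof. exact: measurable_id. Qed.

Lemma branching_mechanismE : phi = mechanism m (idfun : measurableTypeR R -> R) b c.
Proof. by []. Qed.

Lemma branching_mechanism_lipschitz : locally_lipschitz phi.
Proof.
move=> k k0; rewrite branching_mechanismE.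
set I := jump_mass m (idfun : measurableTypeR R -> R) ((idfun : measurableTypeR R -> R) @^-1` `]0, +oo[).
have I0 : 0 <= I by apply: jump_mass_ge0.
have C0 : 0 <= `|b| + c * (k + k) + (1 + k) * I.
  by rewrite !addr_ge0 ?mulr_ge0 ?addr_ge0.
exists (`|b| + c * (k + k) + (1 + k) * I) => // z z'.
wlog zz' : z z' / z <= z'.
  move=> H zk z'k; have [|/ltW] := leP z z'; first by move=> ?; exact: H.
  by move=> ?; rewrite distrC (distrC z'); exact: H.
move=> /andP[z0 zk] /andP[z'0 z'k].
have d0 : 0 <= z' - z by rewrite subr_ge0.
have lo := mechanismB_ge midfun m_branching b c_ge0 z0 zz'.
have up := mechanismB_le midfun m_branching b c z0 zz'.
rewrite -/I in up.
rewrite (ger0_norm d0) ler_norml; apply/andP; split.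
  apply: le_trans lo; rewrite -mulNr ler_wpM2r//.
  have := ler_norm (- b); rewrite normrN => nb.
  have : 0 <= c * (k + k) by rewrite mulr_ge0// addr_ge0.
  have : 0 <= (1 + k) * I by rewrite mulr_ge0// addr_ge0.
  lra.
apply: (le_trans up); rewrite [leRHS]mulrC ler_wpM2l//.
by rewrite !lerD// ?ler_norm// ?ler_wpM2l ?ler_wpM2r// lerD.
Qed.

Lemma branching_mechanism_star : star_shaped phi.
Proof. by move=> a z a01 z0; exact: mechanism_star. Qed.

End branching_mechanism_properties.

Theorem theorem4p5 (R : realType)
  (b c : R) (m : {measure set (measurableTypeR R) -> \bar R})
  (a sigma : R) (nu : {measure set (measurableTypeR R) -> \bar R})
  (d : measure_display) (Om : measurableType d) (P : probability Om R)
  (xi : R -> Om -> R) (v : Om -> R -> R -> R -> R)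
  (Q : R -> R.-pker (measurableTypeR R) ~> (measurableTypeR R))
  (c_ge0 : 0 <= c) (m_branching : branching_measure m)
  (sigma_ge0 : 0 <= sigma) (nu_levy : levy_measure nu)
  (xi_levy : cadlag_levy_process P xi)
  (xi_decomposition : levy_ito_decomposition P a sigma nu xi)
  (v_solution : forall (w : Om) (t lam : R), 0 <= t -> 0 <= lam ->
     cumulant_solution (branching_mechanism b c m) (xi ^~ w) t lam
       (fun r => v w r t lam))
  (grey : grey_condition (branching_mechanism b c m))
  (Q_semigroup : transition_semigroup Q)
  (Q_laplace : forall t lam x : R, 0 <= t -> 0 <= lam -> 0 <= x ->
     (\int[Q t x]_(y in `[0%R, +oo[) (expR (- (lam * y)))%:E =
      'E_P[fun w => expR (- (x * v w 0%R t lam))])%E) :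
  strong_feller Q.
Proof.
move=> t f t0 mf [M fM].
have [Q1 _ _] := Q_semigroup; have [mxi _ _ cxi] := xi_levy.
pose X : measurableTypeR R -> R := idfun.
have mX : measurable_fun setT X by exact: measurable_id.
pose phi := branching_mechanism b c m.
pose phin := approx_mechanism m X b c; pose beta := approx_slope m X b c.
have lip : locally_lipschitz phi := branching_mechanism_lipschitz b c_ge0 m_branching.
have slope n : slopes_between b (beta n) (phin n).
  move=> z z' z0 zz'; apply/andP; split.
    exact: approx_mechanismB_ge.
  exact: approx_mechanismB_le.
have cvg := @approx_mechanism_cvg _ _ _ m X mX m_branching b c c_ge0.
have bernE n h r : 0 <= h -> 0 < r -> h * beta n <= 1 ->
    bernstein (euler_map (phin n) h r).
  exact: approx_mechanism_bernstein.
pose V w lam := v w 0 t lam.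
have VB w : bernstein (V w).
  apply: (cumulant_bernstein lip slope cvg bernE t0 (cxi w)
    (v := fun lam r => v w r t lam)) => lam lam0.
  by apply: v_solution => //; exact: ltW.
have mV lam : 0 <= lam -> measurable_fun setT (V ^~ lam).
  move=> lam0.
  apply: (measurable_cumulant lip slope cvg bernE t0 lam0 mxi cxi
    (v := fun w r => v w r t lam)) => w.
  by apply: v_solution => //; exact: ltW.
have Vbound w : exists z, forall lam, 0 <= lam -> V w lam <= z.
  have [z zP] := cumulant_bounded (branching_mechanism_star b c_ge0 m_branching)
    lip grey (cxi w) t0.
  exists z => lam lam0; apply: (zP lam (fun r => v w r t lam)) => //.
  by apply: v_solution => //; exact: ltW.
have Vcvg w : cvgn (fun n => V w n%:R).
  apply: nondecreasing_is_cvgn.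
    move=> i j ij; apply: (bernstein_nondecreasing (VB w)) => //.
    by rewrite ler_nat.
  by have [z zP] := Vbound w; exists z => _ [n _ <-]; exact: zP.
pose vbar w := limn (fun n => V w n%:R).
have vbar0 w : 0 <= vbar w.
  by apply: limr_ge; [exact: Vcvg|near=> n; exact: (VB w).1].
have mvbar : measurable_fun setT vbar.
  apply: (@measurable_fun_cvg _ _ _ _ (fun n w => V w n%:R)).
    by move=> n; exact: mV.
  by move=> w _; exact: Vcvg.
have PT : (P setT < +oo)%E by rewrite probability_setT ltry.
have bi := @bounded_integrable _ _ _ P setT measurableT PT.
(* The conditional probability that a population started from [h] survives up
   to time [t]. *)
pose D h w : R := 1 - expR (- (h * vbar w)).
have mD h : measurable_fun setT (D h).
  apply: measurable_funB => //; apply: measurableT_comp => //.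
  by apply: measurableT_comp => //; exact: measurable_funM.
have D01 h w : 0 <= h -> 0 <= D h w <= 1.
  by move=> h0; rewrite /D; have := expRN_itv (mulr_ge0 h0 (vbar0 w)); lra.
have D1 h w : 0 <= h -> `|D h w| <= 1.
  by move=> /(D01 _ w)/andP[? ?]; rewrite ger0_norm.
have iD h : 0 <= h -> P.-integrable setT (EFin \o D h).
  by move=> h0; apply: (bi _ 1) => // w _; exact: D1.
pose delta h := \int[P]_(w in setT) D h w.
have iexp x lam : 0 <= x -> 0 <= lam ->
    P.-integrable setT (EFin \o (fun w => expR (- (x * V w lam)))).
  move=> x0 l0; apply: (bi _ 1).
    apply: measurableT_comp => //; apply: measurableT_comp => //.
    by apply: measurable_funM => //; exact: mV.
  move=> w _; have /andP[? ?] := expRN_itv (mulr_ge0 x0 ((VB w).1 _ l0)).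
  by rewrite ger0_norm.
pose S : set (measurableTypeR R) := `[0, +oo[%classic.
have mS : measurable S by exact: measurable_itv.
have S0 u : S u -> 0 <= X u by rewrite /S/= in_itv/= andbT.
have QS x : 0 <= x -> (Q t x S < +oo)%E by move=> x0; rewrite Q1 ?ltry// ltW.
have iQ x lam : 0 <= x -> 0 <= lam ->
    (Q t x).-integrable S (EFin \o (fun u => expR (- (lam * X u)))).
  move=> x0 l0; apply: (@bounded_integrable _ _ _ (Q t x) S mS (QS _ x0) _ 1).
    apply: measurableT_comp => //; apply: measurableT_comp => //.
    exact: measurable_funM.
  move=> u /S0 u0; have /andP[? ?] := expRN_itv (mulr_ge0 l0 u0).
  by rewrite ger0_norm.
have Qexp x s : 0 <= x -> nneg_exps s ->
    \int[Q t x]_(u in S) expsum s (X u) =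
    \int[P]_(w in setT) comb s (fun lam => expR (- (x * V w lam))).
  move=> x0 s0.
  have [_ <-] := comb_Rintegral mS s0 (fun lam l0 => iQ x lam x0 l0).
  have [_ <-] := comb_Rintegral measurableT s0 (fun lam l0 => iexp x lam x0 l0).
  apply: eq_comb => // lam l0; rewrite /Rintegral; congr fine.
  by have := Q_laplace t lam x (ltW t0) l0 x0; rewrite unlock.
have icomb x s : 0 <= x -> nneg_exps s -> P.-integrable setT
    (EFin \o (fun w => comb s (fun lam => expR (- (x * V w lam))))).
  move=> x0 s0.
  by have [] := comb_Rintegral measurableT s0 (fun lam l0 => iexp x lam x0 l0).
have expdelta x h s : 0 <= x -> 0 <= h -> unit_expsum s ->
    `|\int[Q t (x + h)]_(u in S) expsum s (X u)
      - \int[Q t x]_(u in S) expsum s (X u)| <= delta h.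
  move=> x0 h0 us; have xh0 : 0 <= x + h by exact: addr_ge0.
  rewrite !Qexp//; [|exact: us.1..].
  have i1 := icomb _ _ xh0 us.1; have i2 := icomb _ _ x0 us.1.
  rewrite -RintegralB//.
  have iB := integrableB measurableT i1 i2.
  apply: (le_trans (le_normr_Rintegral measurableT iB)).
  apply: le_Rintegral => //; [exact: (integrable_norm iB)|exact: iD|].
  by move=> w _; apply: bernstein_comb_diff => //; exact: Vcvg.
pose F x := \int[Q t x]_(y in `[0, +oo[) f y.
have Fdelta x h : 0 <= x -> 0 <= h ->
    `|F (x + h) - F x| <= 2 * (M + 1) * delta h.
  move=> x0 h0; have xh0 : 0 <= x + h by exact: addr_ge0.
  apply: (@bounded_function_delta _ _ _ (Q t (x + h)) (Q t x) S X mS _ _ mX S0) => //.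
  - by apply: Q1 => //; exact: ltW.
  - by apply: Q1 => //; exact: ltW.
  - by move=> s us; exact: expdelta.
have deltacvg : delta n.+1%:R^-1 @[n --> \oo] --> 0.
  have [] := @dominated_convergence _ _ _ P setT measurableT
    (fun n w => (D n.+1%:R^-1 w)%:E) (fun=> 0%E) (EFin \o (fun=> 1)) _ _ _ _.
  - by move=> n; apply/measurable_EFinP; exact: mD.
  - exact: measurable_cst.
  - apply/aeW => w _; apply: cvg_EFin; first by near=> n.
    rewrite [X in _ --> X](_ : 0 = 1 - expR (- (0 * vbar w))); last first.
      by rewrite mul0r oppr0 expR0 subrr.
    apply: cvgB; first exact: cvg_cst.
    apply: continuous_cvg; first exact: continuous_expR.
    by apply: cvgN; apply: cvgMr_tmp; exact: cvg_harmonic.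
  - by apply: (bi _ 1) => // w _; rewrite normr1.
  - by apply/aeW => w n _; rewrite /= lee_fin D1.
  by move=> _ _; rewrite integral0 => /fine_cvgP[_].
have deltamono h h' : 0 <= h -> h <= h' -> delta h <= delta h'.
  move=> h0 hh'; apply: le_Rintegral => //.
  - exact: iD.
  - by apply: iD; exact: le_trans hh'.
  by move=> w _; rewrite /D lerD2l lerN2 ler_expR lerN2 ler_wpM2r.
have M10 : 0 < 2 * (M + 1).
  by have := fM 0 (lexx 0); have := normr_ge0 (f 0); lra.
apply/subspace_continuousP => x; rewrite /= in_itv/= andbT => x0.
apply/cvgrPdist_le => eps eps0.
have e1 : 0 < eps / (2 * (M + 1)) by rewrite divr_gt0.
move/cvgrPdist_le : deltacvg => /(_ _ e1)[n _ nP].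
have {nP} := nP n (leqnn n); rewrite sub0r normrN => /(le_trans (ler_norm _)).
rewrite ler_pdivlMr// mulrC => nP.
rewrite near_withinE; exists n.+1%:R^-1 => /=; first by rewrite invr_gt0 ltr0n.
move=> y /= xy; rewrite in_itv/= andbT => y0.
apply: le_trans nP; have [xley|/ltW ylex] := leP x y.
  rewrite distrC -[y](subrKC x); apply: (le_trans (Fdelta x (y - x) _ _)) => //.
    by rewrite subr_ge0.
  rewrite ler_pM2l//; apply: deltamono; first by rewrite subr_ge0.
  by apply/ltW/(le_lt_trans _ xy); rewrite distrC; exact: ler_norm.
rewrite -[x](subrKC y); apply: (le_trans (Fdelta y (x - y) _ _)) => //.
  by rewrite subr_ge0.
rewrite ler_pM2l//; apply: deltamono; first by rewrite subr_ge0.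
by apply/ltW/(le_lt_trans _ xy); exact: ler_norm.
Unshelve. all: end_near. Qed.
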